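(* Let $\alpha>0$, let $\mathcal X,\mathcal Y$ be separable metric spaces, and let $(\mathbf X,\mathbf Y)$ be a pair of random variables taking values in $\mathcal X\times\mathcal Y$. (a) If $\mathbb E\|\mathbf X\|^{2\alpha}<\infty$ and $\mathbb E\|\mathbf Y\|^{2\alpha}<\infty$, then all the expectations in the definition of $\mathrm{dcov}^*_\alpha(\mathbf X,\mathbf Y)$ are finite. (b) If $\mathbb E\|\mathbf X\|^{\alpha^*}<\infty$ and $\mathbb E\|\mathbf Y\|^{\alpha^*}<\infty$, then the expectations defining $\widehat{\mathrm{dcov}}_\alpha(\mathbf X,\mathbf Y)$ and $\widetilde{\mathrm{dcov}}_\alpha(\mathbf X,\mathbf Y)$ are finite. (c) Any two of these three definitions yield the same result whenever the moment conditions in both are satisfied (the moment condition for $\mathrm{dcov}^*_\alpha$ being the one in (a), and that for $\widehat{\mathrm{dcov}}_\alpha$ and for $\widetilde{\mathrm{dcov}}_\alpha$ being the one in (b)).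
   Context: Both metrics are denoted $d$. Fix points $\mathbf x_o\in\mathcal X$, $\mathbf y_o\in\mathcal Y$ and write $\|\mathbf x\|:=d(\mathbf x,\mathbf x_o)$, $\|\mathbf y\|:=d(\mathbf y,\mathbf y_o)$ (the choice of these points does not affect the moment conditions). Put $\alpha^*:=\max(\alpha,2\alpha-2)$. Let $(\mathbf X_1,\mathbf Y_1),(\mathbf X_2,\mathbf Y_2),\dots$ be independent copies of $(\mathbf X,\mathbf Y)$. Definitions of $\alpha$-distance covariance: 1. $\mathrm{dcov}^*_\alpha(\mathbf X,\mathbf Y):=\mathbb E[d(\mathbf X_1,\mathbf X_2)^\alpha d(\mathbf Y_1,\mathbf Y_2)^\alpha]+\mathbb E[d(\mathbf X_1,\mathbf X_2)^\alpha]\,\mathbb E[d(\mathbf Y_1,\mathbf Y_2)^\alpha]-2\,\mathbb E[d(\mathbf X_1,\mathbf X_2)^\alpha d(\mathbf Y_1,\mathbf Y_3)^\alpha]$. 2. $\widehat{\mathrm{dcov}}_\alpha(\mathbf X,\mathbf Y):=\frac14\mathbb E[\widehat X_\alpha\widehat Y_\alpha]$, where $\widehat X_\alpha:=d(\mathbf X_1,\mathbf X_2)^\alpha-d(\mathbf X_2,\mathbf X_3)^\alpha+d(\mathbf X_3,\mathbf X_4)^\alpha-d(\mathbf X_4,\mathbf X_1)^\alpha$ and $\widehat Y_\alpha$ is defined in the same way with $\mathbf Y_i$ in place of $\mathbf X_i$. 3. $\widetilde{\mathrm{dcov}}_\alpha(\mathbf X,\mathbf Y):=\mathbb E[\widetilde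 X_\alpha\widetilde Y_\alpha]$, where $\widetilde X_\alpha:=\mathbb E(\widehat X_\alpha\mid\mathbf X_1,\mathbf X_2)=d(\mathbf X_1,\mathbf X_2)^\alpha-\mathbb E_{\mathbf X}d(\mathbf X_1,\mathbf X)^\alpha-\mathbb E_{\mathbf X}d(\mathbf X_2,\mathbf X)^\alpha+\mathbb E\,d(\mathbf X_1,\mathbf X_2)^\alpha$ (with $\mathbb E_{\mathbf X}$ denoting integration over $\mathbf X$ only, $\mathbf X$ being independent of the $\mathbf X_j$), and $\widetilde Y_\alpha:=\mathbb E(\widehat Y_\alpha\mid\mathbf Y_1,\mathbf Y_2)$ similarly. *)

(* Defs.v *)
From HB Require Import structures.
From mathcomp Require Import all_boot all_order all_algebra finmap.
From mathcomp Require Import all_classical all_reals all_analysis.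

Set Implicit Arguments.
Unset Strict Implicit.
Unset Printing Implicit Defensive.

Import Order.TTheory GRing.Theory Num.Theory.
Import numFieldNormedType.Exports.

Local Open Scope classical_set_scope.
Local Open Scope ring_scope.

(* A measurableType carries a default point, hence so must a metric space that
   is given its Borel sigma-algebra. *)
#[short(type="pmetricType")]
HB.structure Definition PointedMetric (R : numDomainType) :=
  {M of Pointed M & Metric R M}.

Definition separable_space (T : topologicalType) : Prop :=
  exists2 D : set T, countable D & dense D.

Notation borel T := (g_sigma_algebraType (@open T)).

Section probability.
Context {R : realType} {d : measure_display} {Omega : measurableType d}.
Variable P : probability Omega R.

Definition mutually_independent {d' : measure_display} {T : measurableType d'}
    (Z : nat -> {RV P >-> T}) : Prop :=
  forall (J : {fset nat}) (A : nat -> set T), (forall j, measurable (A j)) ->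
    P (\bigcap_(j in [set` J]) (Z j @^-1` A j)) =
    (\prod_(j <- J) P (Z j @^-1` A j))%E.

Definition independent_copies {d0 d' : measure_display}
    {Omega0 : measurableType d0} {P0 : probability Omega0 R}
    {T : measurableType d'} (Z0 : {RV P0 >-> T}) (Z : nat -> {RV P >-> T}) :
    Prop :=
  (forall i A, measurable A -> distribution P (Z i) A = distribution P0 Z0 A) /\
  mutually_independent Z.

Definition has_finite_expectation (f : Omega -> R) : Prop :=
  P.-integrable [set: Omega] (EFin \o f).

Definition is_condexp (G : set_system Omega) (f g : Omega -> R) : Prop :=
  [/\ has_finite_expectation f, has_finite_expectation g,
      forall B : set R, measurable B -> G (g @^-1` B) &
      forall A, G A ->
        (\int[P]_(w in A) (g w)%:E = \int[P]_(w in A) (f w)%:E)%E].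

(* A version of E(f | G); it is unique only up to P-null sets. The value 0 is
   used when there is none, which for a sub-sigma-algebra G only happens when
   f is not integrable. *)
Definition condexp (G : set_system Omega) (f : Omega -> R) : Omega -> R :=
  xget (cst 0) [set g | is_condexp G f g].

End probability.

(* In the sequences V below, the index i stands for the (i+1)-st copy. *)
Section dcov.
Context {R : realType} {d : measure_display} {Omega : measurableType d}.
Variables (P : probability Omega R) (a : R).

Definition dist_pow {T : pmetricType R} (V W : Omega -> T) : Omega -> R :=
  fun w => mdist (V w) (W w) `^ a.

Definition dist_hat {T : pmetricType R} (V : nat -> Omega -> T) : Omega -> R :=
  dist_pow (V 0) (V 1) \- dist_pow (V 1) (V 2)
  \+ dist_pow (V 2) (V 3) \- dist_pow (V 3) (V 0).

Definition sigma_pair {T : pmetricType R} (V W : Omega -> T) :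
    set_system Omega :=
  g_sigma_algebra_preimage (fun w => (V w, W w) : borel T * borel T).

Definition dist_tilde {T : pmetricType R} (V : nat -> Omega -> T) :
    Omega -> R :=
  condexp P (sigma_pair (V 0) (V 1)) (dist_hat V).

Context {S T : pmetricType R}.
Variables (X : nat -> Omega -> S) (Y : nat -> Omega -> T).

Definition dcov_star : \bar R :=
  ('E_P[dist_pow (X 0) (X 1) \* dist_pow (Y 0) (Y 1)]
   + 'E_P[dist_pow (X 0) (X 1)] * 'E_P[dist_pow (Y 0) (Y 1)]
   - 2%:E * 'E_P[dist_pow (X 0) (X 1) \* dist_pow (Y 0) (Y 2)])%E.

Definition dcov_star_finite : Prop :=
  [/\ has_finite_expectation P (dist_pow (X 0) (X 1) \* dist_pow (Y 0) (Y 1)),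
      has_finite_expectation P (dist_pow (X 0) (X 1)),
      has_finite_expectation P (dist_pow (Y 0) (Y 1)) &
      has_finite_expectation P (dist_pow (X 0) (X 1) \* dist_pow (Y 0) (Y 2))].

Definition dcov_hat : \bar R :=
  ((4^-1)%:E * 'E_P[dist_hat X \* dist_hat Y])%E.

Definition dcov_hat_finite : Prop :=
  has_finite_expectation P (dist_hat X \* dist_hat Y).

Definition dcov_tilde : \bar R := 'E_P[dist_tilde X \* dist_tilde Y]%E.

(* The expectations entering dist_tilde V, both in its definition and in the
   closed form d(V1,V2)^a - E_V d(V1,V)^a - E_V d(V2,V)^a + E d(V1,V2)^a. *)
Definition dist_tilde_finite {U : pmetricType R} (V : nat -> Omega -> U) :
    Prop :=
  [/\ has_finite_expectation P (dist_hat V),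
      has_finite_expectation P (dist_pow (V 0) (V 1)) &
      forall u : U, has_finite_expectation P (dist_pow (cst u) (V 0))].

Definition dcov_tilde_finite : Prop :=
  [/\ dist_tilde_finite X, dist_tilde_finite Y &
      has_finite_expectation P (dist_tilde X \* dist_tilde Y)].

End dcov.

(* E ||V||^p < oo, where ||v|| = d(v, o) *)
Definition finite_moment {R : realType} {d : measure_display}
    {Omega : measurableType d} (P : probability Omega R) {T : pmetricType R}
    (o : T) (p : R) (V : Omega -> T) : Prop :=
  ('E_P[(fun w => mdist (V w) o `^ p)%R] < +oo)%E.

Definition alpha_star {R : realType} (a : R) : R := Num.max a (2 * a - 2).

(* Main.v *)
(* Write h for the weight 1 + |x|^(alpha^*/2), whose square is integrable under
   the moment condition of (b). The cycle sum X^ = d(X1,X2)^a - d(X2,X3)^a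
   + d(X3,X4)^a - d(X4,X1)^a satisfies |X^| <= C h(X1) h(X2) h(X3) h(X4), so by
   independence X^ Y^ is integrable, and so is every product of pair functions
   met below. Let t(u,v) = d(u,v)^a - E d(u,X)^a - E d(v,X)^a + E d(X1,X2)^a be
   the centered kernel. The means cancel around the cycle, so
   X^ = t12 - t23 + t34 - t41, and integrating out a variable that occurs only
   in t gives 0. Hence t(X1,X2) is E(X^ | X1,X2), and by cyclic symmetry
   E[X^ Y^] = 4 E[X~ Y~]. Expanding one centered factor of E[X~ Y~] in the same
   way yields the formula defining dcov^*. *)

Require Import Defs.
From mathcomp Require Import all_boot all_order all_algebra finmap ring lra.
From mathcomp Require Import all_classical all_reals all_analysis.
From mathcomp Require Import measurable_realfun.

Set Implicit Arguments.
Unset Strict Implicit.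
Unset Printing Implicit Defensive.

Import Order.TTheory GRing.Theory Num.Theory.
Import numFieldNormedType.Exports.

Local Open Scope classical_set_scope.
Local Open Scope ring_scope.

(** * Bounds on powers of distances *)

(** The obstacle is that [alpha_star a] is smaller than [2 * a]: under the moment condition of (b) a
    single power d(X1,X2)^a is integrable but need not be square integrable. Products may then
    contain cycle sums and centered kernels only, never raw powers. The gain comes from cancellation
    between neighbouring sides of a quadrilateral. If A <= B bound its two diagonals, the cycle sum
    is of order A (A+B)^(a-1), or A^a when a <= 1, and sharing this quantity evenly between A and B
    produces the exponent alpha^*/2. The expansion leading to dcov^* does contain products of raw
    powers, and there the weight has exponent a, whose square needs the moment 2a. The arguments on
    kernels are therefore stated for an abstract weight, and both exponents are substituted at the
    end. The pairs (X_i, Y_i) form one i.i.d. sequence on which both kernels are read through the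
    coordinates. Since X_i and Y_i may be dependent, two weights meet at each copy, which is why
    squares of weights have to be integrable. *)

Section powR_inequalities.
Context {R : realType}.
Implicit Types a x y A B : R.

(** Divided by [x + y], the two terms lie in [0,1] and sum to 1, and t <= t^a on [0,1]. *)
Lemma powR_subadd a x y : 0 < a -> a <= 1 -> 0 <= x -> 0 <= y ->
  (x + y) `^ a <= x `^ a + y `^ a.
Proof.
move=> a0 a1 x0 y0.
have [xy0|xy0] := eqVneq (x + y) 0.
  by rewrite xy0 powR0 ?gt_eqF// addr_ge0 ?powR_ge0.
have {}xy0 : 0 < x + y by rewrite lt_neqAle eq_sym xy0 addr_ge0.
have h z : 0 <= z -> z <= x + y -> z / (x + y) <= (z / (x + y)) `^ a.
  move=> z0 zxy; have [->|zn0] := eqVneq z 0; first by rewrite mul0r powR_ge0.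
  by rewrite ger1_powR// divr_gt0 ?ler_pdivrMr ?mul1r //= lt_neqAle eq_sym zn0.
have -> : x `^ a + y `^ a =
    (x + y) `^ a * ((x / (x + y)) `^ a + (y / (x + y)) `^ a).
  rewrite mulrDr -!powRM ?divr_ge0// ?(ltW xy0)//.
  by rewrite !(mulrC (x + y)) !mulfVK ?gt_eqF.
rewrite ler_peMr ?powR_ge0//.
rewrite (@le_trans _ _ (x / (x + y) + y / (x + y)))//.
  by rewrite -mulrDl divff ?gt_eqF.
by rewrite lerD// h// ?lerDl ?lerDr.
Qed.

Lemma powR_dist_le1 a x y : 0 < a -> a <= 1 -> 0 <= x -> 0 <= y ->
  `|x `^ a - y `^ a| <= `|x - y| `^ a.
Proof.
move=> a0 a1; wlog yx : x y / y <= x => [h x0 y0|x0 y0].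
  have [/h|/ltW/h] := leP y x; first exact.
  by move=> H; rewrite distrC (distrC x); exact: H.
have a_ge0 := ltW a0.
rewrite !ger0_norm ?subr_ge0// ?ge0_ler_powR ?nnegrE//.
rewrite lerBlDr (le_trans _ (powR_subadd _ _ _ _)) ?subr_ge0//.
by rewrite subrK.
Qed.

(** Bernoulli's inequality, which stands in for the mean value theorem below: an integer above the
    real exponent serves as Lipschitz constant. *)
Lemma onem_expr_le (n : nat) x : 0 <= x -> x <= 1 ->
  1 - x ^+ n <= n%:R * (1 - x).
Proof.
move=> x0 x1; elim: n => [|n ih]; first by rewrite expr0 subrr mul0r.
rewrite exprS -natr1.
have : 0 <= x ^+ n <= 1 by rewrite exprn_ge0// exprn_ile1.
by move: (x ^+ n) ih => z; nra.
Qed.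

(** By homogeneity one divides by the larger number [x]. With t = y/x in [0,1] and an integer n
    above a, 1 - t^a <= 1 - t^n <= n (1 - t). *)
Lemma powR_dist_ge1 a : 1 <= a -> exists n : nat, forall x y M,
  0 <= x -> x <= M -> 0 <= y -> y <= M ->
  `|x `^ a - y `^ a| <= n%:R * `|x - y| * M `^ (a - 1).
Proof.
move=> a1; exists (Num.truncn a).+1 => x y M.
have a0 : 0 < a by lra.
wlog yx : x y / y <= x => [h x0 xM y0 yM|x0 xM y0 yM].
  have [/h|/ltW/h] := leP y x; first exact.
  by move=> H; rewrite distrC (distrC x); exact: H.
have a_ge0 := ltW a0.
rewrite !ger0_norm ?subr_ge0// ?ge0_ler_powR ?nnegrE//.
have [x00|xn0] := eqVneq x 0.
  have -> : y = 0 by apply/le_anti; rewrite y0 -x00 yx.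
  by rewrite x00 !subrr mulr0 mul0r.
have {}xn0 : 0 < x by rewrite lt_neqAle eq_sym xn0.
apply: (@le_trans _ _ ((Num.truncn a).+1%:R * (x - y) * x `^ (a - 1)));
  last first.
  rewrite ler_wpM2l ?mulr_ge0 ?subr_ge0// ge0_ler_powR ?nnegrE ?subr_ge0//.
  exact: le_trans xM.
have t0 : 0 <= y / x by rewrite divr_ge0.
have t1 : y / x <= 1 by rewrite ler_pdivrMr ?mul1r.
have -> : y `^ a = x `^ a * (y / x) `^ a.
  by rewrite -powRM// mulrC mulfVK// gt_eqF.
rewrite -[X in X - _]mulr1 -mulrBr -(mulr_powRB1 x0)//.
have -> : x - y = x * (1 - y / x)
  by rewrite mulrBr mulr1 mulrCA divff ?mulr1// gt_eqF.
rewrite [leRHS](_ : _ = x * x `^ (a - 1) * ((Num.truncn a).+1%:R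
  * (1 - y / x))); last by ring.
rewrite ler_wpM2l ?mulr_ge0 ?powR_ge0//.
apply: le_trans (onem_expr_le _ t0 t1).
rewrite lerD2l lerN2 -powR_mulrn//.
have [->|tn0] := eqVneq (y / x) 0; first by rewrite powR0 ?powR_ge0.
by apply: ger_powR; [rewrite t1 lt_neqAle eq_sym tn0 t0|exact/ltW/truncnS_gt].
Qed.

(** The sum is at most twice the larger term. The right side is a product so that independent
    variables separate. *)
Lemma powR_addr_le (q : R) x y : 0 <= q -> 0 <= x -> 0 <= y ->
  (x + y) `^ q <= 2 `^ q * ((1 + x `^ q) * (1 + y `^ q)).
Proof.
move=> q0; wlog xy : x y / y <= x => [h x0 y0|x0 y0].
  have [/h|/ltW/h] := leP y x; first exact.
  by move=> H; rewrite addrC [X in _ * X]mulrC; exact: H.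
apply: (@le_trans _ _ ((2 * x) `^ q)).
  by rewrite ge0_ler_powR ?nnegrE ?mulr_ge0 ?addr_ge0//; lra.
rewrite powRM// ler_wpM2l ?powR_ge0//.
by have := powR_ge0 x q; have := powR_ge0 y q; nra.
Qed.

Lemma alpha_star_half a : 0 < a ->
  (a <= 2 /\ alpha_star a / 2 = a / 2) \/ (2 <= a /\ alpha_star a / 2 = a - 1).
Proof.
move=> a0; rewrite /alpha_star; have [a2|a2] := leP a 2.
  by left; split => //; rewrite max_l//; lra.
by right; split; [exact: ltW|rewrite max_r; lra].
Qed.

(** The origin of alpha^*: up to a constant the left side is at most A B^(a-1). If a <= 2, the
    factor A^(1-a/2) is moved onto the larger B, and both exponents become a/2. If a >= 2, B already
    has exponent a-1 and A <= 1 + A^(a-1). *)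
Lemma min_powR_bound a A B : 1 <= a -> 0 <= A -> A <= B ->
  A * (A + B) `^ (a - 1) <=
  2 `^ (a - 1) * ((1 + A `^ (alpha_star a / 2)) * (1
    + B `^ (alpha_star a / 2))).
Proof.
move=> a1 A0 AB; have B0 := le_trans A0 AB.
have a10 : 0 <= a - 1 by lra.
apply: (@le_trans _ _ (A * (2 * B) `^ (a - 1))).
  rewrite ler_wpM2l// (ge0_ler_powR a10)// ?nnegrE ?(addr_ge0 A0) ?mulr_ge0//;
    lra.
rewrite powRM// mulrCA ler_wpM2l ?powR_ge0//.
have [] := @alpha_star_half a; first lra; move=> [a2 ->]; last first.
  apply: ler_pM => //; [exact: powR_ge0| |by rewrite lerDr].
  have [A1|A1] := leP A 1; first by rewrite (le_trans A1)// lerDl powR_ge0.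
  by rewrite (@le_trans _ _ (A `^ (a - 1))) ?lerDr// le1r_powR//; lra.
apply: (@le_trans _ _ (A `^ (a / 2) * B `^ (a / 2))).
  have {1}-> : A = A `^ (a / 2) * A `^ (1 - a / 2).
    by rewrite -powRD subrKC ?powRr1// oner_eq0.
  rewrite -mulrA ler_wpM2l ?powR_ge0//.
  apply: (@le_trans _ _ (B `^ (1 - a / 2) * B `^ (a - 1))).
    by rewrite ler_wpM2r ?powR_ge0// ge0_ler_powR ?nnegrE//; lra.
  rewrite -powRD; first by rewrite le_eqVlt; apply/orP; left; apply/eqP;
    congr (_ `^ _); lra.
  by apply/implyP => /eqP; lra.
by apply: ler_pM; rewrite ?powR_ge0 ?lerDr.
Qed.

Lemma min_powR_bound_le1 a A B : 0 < a -> a <= 1 -> 0 <= A -> A <= B ->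
  A `^ a <= (1 + A `^ (alpha_star a / 2)) * (1 + B `^ (alpha_star a / 2)).
Proof.
move=> a0 a1 A0 AB; have B0 := le_trans A0 AB.
have [[_ ->]|[]] := @alpha_star_half a a0; last by lra.
have {1}-> : a = a / 2 + a / 2 by lra.
rewrite powRD; last by apply/implyP => /eqP; lra.
apply: ler_pM; rewrite ?powR_ge0 ?lerDr//.
by rewrite (@le_trans _ _ (B `^ (a / 2))) ?lerDr// ge0_ler_powR ?nnegrE//; lra.
Qed.

End powR_inequalities.

Section metric_bounds.
Context {R : realType}.

Lemma metric_triangle_sym (M : metricType R) (x y z : M) :
  mdist x z <= mdist x y + mdist z y.
Proof. by rewrite (metric_sym z y); exact: metric_triangle. Qed.

(** The summand 1 keeps weights at least 1, so that further factors can be inserted into an upper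
    bound. *)
Definition mdist_weight (p : R) (M : metricType R) (o x : M) : R :=
  1 + mdist x o `^ p.

Lemma mdist_weight_ge1 p (M : metricType R) (o x : M) : 1 <= mdist_weight p o x.
Proof. by rewrite lerDl powR_ge0. Qed.

Lemma mdist_pow_bound (a : R) (M : metricType R) (o x y : M) : 0 < a ->
  mdist x y `^ a <= 2 `^ a * (mdist_weight a o x * mdist_weight a o y).
Proof.
move=> a0; apply: (@le_trans _ _ ((mdist x o + mdist y o) `^ a)).
  by rewrite (ge0_ler_powR (ltW a0))// ?nnegrE ?addr_ge0 ?mdist_ge0
    ?metric_triangle_sym.
by rewrite powR_addr_le ?mdist_ge0 ?ltW.
Qed.

(* Grouping the four terms as (01 - 12) + (23 - 30) or as (01 - 30) + (23 - 12)
   compares distances to a common point, so the sum is controlled by d(x0,x2)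
   as well as by d(x1,x3). *)
Lemma mdist_pow_cycle_bound (a : R) (q := alpha_star a / 2) : 0 < a ->
  exists2 C, 0 <= C &
  forall (M : metricType R) (o x0 x1 x2 x3 : M),
  `|mdist x0 x1 `^ a - mdist x1 x2 `^ a + mdist x2 x3 `^ a - mdist x3 x0 `^ a|
    <= C * (mdist_weight q o x0 * mdist_weight q o x1 *
      mdist_weight q o x2 * mdist_weight q o x3).
Proof.
move=> a0.
have q0 : 0 < q by rewrite /q; have [[_ ->]|[? ->]] := alpha_star_half a0; lra.
have triB (M : metricType R) (x y z : M) :
  `|mdist x y - mdist y z| <= mdist x z.
  rewrite ler_norml; apply/andP; split.
    by have := metric_triangle y x z; rewrite (metric_sym y x); lra.
  by have := metric_triangle x z y; rewrite (metric_sym z y); lra.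
(* [A] and [B] bound the diagonals d(x0,x2) and d(x1,x3) through [o]. The claim treats them
   symmetrically, so the proof may use the smaller one. *)
have [K K0 HK] : exists2 K : R, 0 <= K &
  forall (M : metricType R) (o x0 x1 x2 x3 : M),
    forall A B, A = mdist x0 o + mdist x2 o -> B = mdist x1 o + mdist x3 o ->
    `|mdist x0 x1 `^ a - mdist x1 x2 `^ a + mdist x2 x3 `^ a - mdist x3 x0 `^ a|
    <= K * ((1 + A `^ q) * (1 + B `^ q)).
  have [a1|/ltW a1] := leP a 1.
    exists 2; first by [].
    move=> M o x0 x1 x2 x3 A B AE BE.
    have DA : mdist x0 x2 <= A by rewrite AE metric_triangle_sym.
    have DB : mdist x1 x3 <= B by rewrite BE metric_triangle_sym.
    have step (D : R) (x y z t : M) : mdist x z <= D ->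
      `|mdist x y `^ a - mdist y z `^ a + (mdist z t `^ a - mdist t x `^ a)|
        <= 2 * D `^ a.
      move=> xzD; rewrite (le_trans (ler_normD _ _))// mulr_natl mulr2n lerD//.
        rewrite (le_trans (powR_dist_le1 _ _ _ _)) ?mdist_ge0//.
        by rewrite ge0_ler_powR ?nnegrE ?(ltW a0) ?(le_trans _ xzD) ?mdist_ge0
          ?(le_trans (triB _ _ _ _)).
      rewrite (le_trans (powR_dist_le1 _ _ _ _)) ?mdist_ge0//.
      rewrite ge0_ler_powR ?nnegrE ?(ltW a0) ?(le_trans _ xzD) ?mdist_ge0//.
      by rewrite (metric_sym x z) triB.
    have A0 : 0 <= A by rewrite AE addr_ge0 ?mdist_ge0.
    have B0 : 0 <= B by rewrite BE addr_ge0 ?mdist_ge0.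
    have [AB|/ltW BA] := leP A B.
      rewrite -[X in `|X|]addrA; apply: le_trans (step A _ _ _ _ DA) _.
      by rewrite ler_wpM2l// min_powR_bound_le1.
    (* Starting the cycle at [x1] changes its sign and exchanges the two diagonals. *)
    rewrite (_ : _ - _ = - ((mdist x1 x2 `^ a - mdist x2 x3 `^ a) +
      (mdist x3 x0 `^ a - mdist x0 x1 `^ a))); last by ring.
    rewrite normrN (le_trans (step B _ _ _ _ DB))//.
    by rewrite ler_wpM2l// mulrC min_powR_bound_le1.
  have [n Hn] := powR_dist_ge1 a1.
  (* Two differences of powers, each with Lipschitz constant [n]; the factor [2 ^ (a - 1)] pays for
     bounding [A + B] by twice the larger of the two. *)
  exists (2 * n%:R * 2 `^ (a - 1)); first by rewrite !mulr_ge0 ?powR_ge0.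
  move=> M o x0 x1 x2 x3 A B AE BE.
  have A0 : 0 <= A by rewrite AE addr_ge0 ?mdist_ge0.
  have B0 : 0 <= B by rewrite BE addr_ge0 ?mdist_ge0.
  have DA : mdist x0 x2 <= A by rewrite AE metric_triangle_sym.
  have DB : mdist x1 x3 <= B by rewrite BE metric_triangle_sym.
  have r x : 0 <= mdist x o by rewrite mdist_ge0.
  have dr x y : mdist x y <= mdist x o + mdist y o.
    exact: metric_triangle_sym.
  have step (D : R) (x y z t : M) : mdist x z <= D ->
      mdist x y <= A + B -> mdist y z <= A + B -> mdist z t <= A + B ->
      mdist t x <= A + B ->
    `|mdist x y `^ a - mdist y z `^ a + (mdist z t `^ a - mdist t x `^ a)|
        <= 2 * n%:R * (D * (A + B) `^ (a - 1)).
    move=> xzD h1 h2 h3 h4; rewrite (le_trans (ler_normD _ _))//.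
    rewrite -mulrA mulr_natl mulr2n !mulrA lerD//.
      rewrite (le_trans (Hn _ _ (A + B) _ _ _ _)) ?mdist_ge0//.
      by rewrite ler_wpM2r ?powR_ge0// ler_wpM2l// (le_trans (triB _ _ _ _)).
    rewrite (le_trans (Hn _ _ (A + B) _ _ _ _)) ?mdist_ge0//.
    rewrite ler_wpM2r ?powR_ge0// ler_wpM2l// (le_trans (triB _ _ _ _))//.
    by rewrite (metric_sym z x).
  have e01 : mdist x0 x1 <= A + B by rewrite (le_trans (dr _ _))// AE BE;
    have := r x2; have := r x3; lra.
  have e12 : mdist x1 x2 <= A + B by rewrite (le_trans (dr _ _))// AE BE;
    have := r x0; have := r x3; lra.
  have e23 : mdist x2 x3 <= A + B by rewrite (le_trans (dr _ _))// AE BE;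
    have := r x0; have := r x1; lra.
  have e30 : mdist x3 x0 <= A + B by rewrite (le_trans (dr _ _))// AE BE;
    have := r x1; have := r x2; lra.
  have [AB|/ltW BA] := leP A B.
    rewrite -[X in `|X|]addrA; apply: le_trans
      (step A _ _ _ _ DA e01 e12 e23 e30) _.
    by rewrite -[leRHS]mulrA ler_wpM2l ?mulr_ge0// min_powR_bound.
  rewrite (_ : _ - _ = - ((mdist x1 x2 `^ a - mdist x2 x3 `^ a) +
    (mdist x3 x0 `^ a - mdist x0 x1 `^ a))); last by ring.
  rewrite normrN (le_trans (step B _ _ _ _ DB e12 e23 e30 e01))//.
  rewrite -[leRHS]mulrA ler_wpM2l ?mulr_ge0//.
  by rewrite (addrC A B) [X in _ <= _ * X]mulrC min_powR_bound.
(* One factor [1 + 2 ^ q] per diagonal, for splitting the power of a sum of two norms into two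
   weights. *)
exists (K * (1 + 2 `^ q) ^+ 2);
  first by rewrite mulr_ge0 ?exprn_ge0 ?addr_ge0 ?powR_ge0.
move=> M o x0 x1 x2 x3; pose h := mdist_weight q o.
apply: le_trans (HK M o x0 x1 x2 x3 _ _ erefl erefl) _;
  rewrite -[leRHS]mulrA ler_wpM2l//.
have h1 x : 1 <= h x by rewrite mdist_weight_ge1.
have hA x y : 1 + (mdist x o + mdist y o) `^ q <= (1 + 2 `^ q) * (h x * h y).
  rewrite [leRHS]mulrDl mul1r lerD ?mulr_ege1//.
  exact: powR_addr_le (ltW q0) (mdist_ge0 x o) (mdist_ge0 y o).
rewrite [leRHS](_ : _ = (1 + 2 `^ q) * (h x0 * h x2) *
  ((1 + 2 `^ q) * (h x1 * h x3))); last by rewrite /h; ring.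
by rewrite ler_pM ?addr_ge0 ?powR_ge0.
Qed.

End metric_bounds.

(** * Measurability and laws of independent copies *)

Section metric_measurability.
Context {R : realType} {M : pmetricType R}.

Lemma metric_ball_open (x : M) (r : R) : open (ball x r).
Proof.
rewrite openE => y; rewrite ballEmdist/= => xyr.
apply/nbhs_ballP; exists (r - mdist x y) => /=; first by rewrite subr_gt0.
move=> z; rewrite !ballEmdist/= => yz.
by have := metric_triangle x y z; lra.
Qed.

Lemma measurable_mdist_cst (q : M) :
  measurable_fun [set: borel M] (fun x : borel M => mdist (x : M) q).
Proof.
apply: (measurability _ (RGenInftyO.measurableE R)) => _ [_ [r ->] <-].
rewrite setTI; apply: sub_sigma_algebra.
rewrite (_ : _ @^-1` _ = ball q r); first exact: metric_ball_open.
by rewrite ballEmdist; apply/seteqP; split=> x /=; rewrite in_itv/= metric_sym.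
Qed.

(** Continuity alone does not suffice, since open sets of the square need not lie in the product of
    the Borel sigma-algebras. A countable dense set of intermediate points reduces the claim to
    distances from fixed points. *)
Lemma measurable_mdist : separable_space M ->
  measurable_fun [set: borel M * borel M]
    (fun z : borel M * borel M => mdist (z.1 : M) (z.2 : M)).
Proof.
move=> [D cD dD].
apply: (measurability _ (RGenInftyO.measurableE R)) => _ [_ [r ->] <-].
rewrite setTI.
have -> : (fun z : borel M * borel M => mdist (z.1 : M) (z.2 : M)) @^-1`
      `]-oo, r[%classic =
    \bigcup_(q in D) [set z | mdist (z.1 : M) q + mdist (z.2 : M) q < r].
  apply/seteqP; split => [[x y]|[x y] [q Dq]]; rewrite /= in_itv/=; last first.
    by apply: le_lt_trans; exact: metric_triangle_sym.
  (* Half the slack: passing through q costs d(x,q) twice. *)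
  move=> xyr; pose e := (r - mdist x y) / 2.
  have e0 : 0 < e by rewrite divr_gt0// subr_gt0.
  have [] := dD (ball x e);
    [by exists x; exact: ballxx|exact: metric_ball_open|].
  move=> q []; rewrite ballEmdist /= => xq Dq; exists q => //=.
  have := metric_triangle y x q; rewrite (metric_sym y x) => yq.
  by rewrite /e in xq; lra.
rewrite bigcup_set_type; apply: countable_bigcupT_measurable => [|q].
  by rewrite (eq_countable (card_setT _)).
pose f (z : borel M * borel M) : R :=
  mdist (z.1 : M) (val q) + mdist (z.2 : M) (val q).
have mf : measurable_fun setT f.
  by apply: measurable_funD; apply: (measurableT_comp (measurable_mdist_cst _)).
have := mf measurableT _ (measurable_itv `]-oo, r[); rewrite setTI.
by congr measurable; apply/seteqP; split=> z /=; rewrite in_itv.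
Qed.

End metric_measurability.

(* Typed as a probability, so that structure inference succeeds on nested
   products. *)
Definition prod_law {R : realType} d1 d2 (T1 : measurableType d1)
    (T2 : measurableType d2) (m1 : probability T1 R) (m2 : probability T2 R) :
    probability (T1 * T2)%type R := (m1 \x m2)%E.

Section product_laws.
Context {R : realType} {d : measure_display} {Omega : measurableType d}.
Variable P : probability Omega R.
Local Open Scope ereal_scope.

Lemma finite_measure_rectangle_unique d1 d2 (T1 : measurableType d1)
    (T2 : measurableType d2) (m m' : {measure set (T1 * T2) -> \bar R}) :
  m setT < +oo ->
  (forall A B, measurable A -> measurable B -> m (A `*` B) = m' (A `*` B)) ->
  forall C, measurable C -> m C = m' C.
Proof.
move=> moo mm' C mC.
apply: (measure_unique [set A `*` B | A in measurable & B in measurable]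
  (fun=> setT)) => //.
- by rewrite measurable_prod_measurableType.
- move=> _ _ [A mA [B mB <-]] [A' mA' [B' mB' <-]]; rewrite -setXI.
  by exists (A `&` A'); [exact: measurableI|exists (B `&` B') => //;
    exact: measurableI].
- by move=> _; exists setT => //; exists setT => //; rewrite setXTT.
- by rewrite bigcup_const.
- by move=> _ [A mA [B mB <-]]; exact: mm'.
Qed.

(** The event [E] carries the coordinates already split off, so that the laws of three and four
    copies follow by applying this two-factor case repeatedly. *)
Lemma pair_law d1 d2 (U1 : measurableType d1) (U2 : measurableType d2)
    (m1 : probability U1 R) (m2 : probability U2 R) (E : set Omega)
    (V : Omega -> U1) (W : Omega -> U2) :
  measurable E -> measurable_fun setT V -> measurable_fun setT W ->
  (forall A B, measurable A -> measurable B ->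
    P (E `&` (V @^-1` A `&` W @^-1` B)) = P E * (m1 A * m2 B)) ->
  forall C, measurable C ->
  P (E `&` (fun w => (V w, W w)) @^-1` C) = P E * prod_law m1 m2 C.
Proof.
move=> mE mV mW PE C mC.
have mVW : measurable_fun setT (fun w => (V w, W w))
  by exact: measurable_fun_pair.
have [m mEq] : exists m : {measure set (U1 * U2) -> \bar R},
    forall A, m A = P (E `&` (fun w => (V w, W w)) @^-1` A).
  by unshelve eexists (pushforward (mrestr P mE)
    (fun w => (V w, W w))) => // A; rewrite /= /pushforward /mrestr setIC.
pose c := NngNum (fine_ge0 (measure_ge0 P E)).
have cE : (c%:num)%:E = P E by apply: fineK; exact: fin_num_measure.
rewrite -mEq
  (@finite_measure_rectangle_unique _ _ _ _ m (mscale c (m1 \x m2)))//.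
- by rewrite -cE.
- by rewrite mEq preimage_setT setIT (le_lt_trans (probability_le1 _ _)) ?ltry.
- move=> A B mA mB; rewrite mEq -[RHS]/((c%:num)%:E * (m1 \x m2) (A `*` B)) cE.
  by rewrite product_measure1E// -PE.
Qed.

(** The inner integral is over the first factor: with products nested to the right, this removes the
    leading copy and leaves a function of the remaining ones. *)
Lemma prod_law_Fubini d1 d2 (T1 : measurableType d1) (T2 : measurableType d2)
    (m1 : probability T1 R) (m2 : probability T2 R) (f : T1 * T2 -> \bar R) :
  (prod_law m1 m2).-integrable setT f ->
  m2.-integrable setT (fun y => \int[m1]_x f (x, y)) /\
  \int[prod_law m1 m2]_z f z = \int[m2]_y \int[m1]_x f (x, y).
Proof.
move=> fi; split.
  apply/integrableP; split; first exact: (measurable_fubini_G fi).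
  have mf := measurable_int _ fi.
  have foo := (@integrable21ltyP _ _ _ _ _ m1 m2 f mf).1 fi.
  apply: le_lt_trans foo.
  apply: ge0_le_integral => //.
  - by apply: measurableT_comp => //; exact: (measurable_fubini_G fi).
  - apply: (@measurable_fun_fubini_tonelli_G _ _ _ _ _ m1 (abse \o f)).
      exact: measurableT_comp.
    by move=> z; exact: abse_ge0.
  - move=> y _; apply: le_abse_integral => //.
    exact: measurable_fun_pair1.
by rewrite -(integral21_prod_meas1 fi).
Qed.

Lemma prod_integrable d1 d2 (T1 : measurableType d1) (T2 : measurableType d2)
    (m1 : probability T1 R) (m2 : probability T2 R)
    (f : T1 -> R) (g : T2 -> R) :
  m1.-integrable setT (EFin \o f) -> m2.-integrable setT (EFin \o g) ->
  (prod_law m1 m2).-integrable setT (fun z => (f z.1 * g z.2)%:E).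
Proof.
move=> fi gi.
have mf : measurable_fun setT f by move: fi => /measurable_int/measurable_EFinP.
have mg : measurable_fun setT g by move: gi => /measurable_int/measurable_EFinP.
apply/integrable12ltyP.
  by apply/measurable_EFinP/measurable_funM; exact: measurableT_comp.
rewrite [ltLHS](_ : _ = \int[m1]_x (`|(f x)%:E| * \int[m2]_y `|(g y)%:E|)).
  have /integrableP[_ foo] := fi; have /integrableP[_ goo] := gi.
  rewrite ge0_integralZr//; last 2 first.
    by apply: measurableT_comp => //; exact/measurable_EFinP.
    by apply: integral_ge0.
  by rewrite lte_mul_pinfty ?integral_ge0 ?ge0_fin_numE ?integral_ge0.
apply: eq_integral => x _; rewrite -ge0_integralZl//.
  by apply: eq_integral => y _; rewrite EFinM abseM.
by apply: measurableT_comp => //; exact/measurable_EFinP.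
Qed.

End product_laws.

Section transfer.
Context {R : realType} {d d' : measure_display} {Omega : measurableType d}
  {T : measurableType d'}.
Variables (P : probability Omega R) (m : probability T R) (W : Omega -> T).
Hypothesis mW : measurable_fun setT W.
Hypothesis lawW : forall C, measurable C -> P (W @^-1` C) = m C.
Local Open Scope ereal_scope.

Lemma law_ge0_integral (f : T -> \bar R) : measurable_fun setT f ->
  (forall x, 0 <= f x) -> \int[P]_w f (W w) = \int[m]_x f x.
Proof.
move=> mf f0; have := @ge0_integral_pushforward _ _ _ _ _ W mW P setT f
  measurableT mf.
rewrite preimage_setT => /(_ (fun x _ => f0 x)) <-.
by apply: eq_measure_integral => A mA _; rewrite /= /pushforward lawW.
Qed.

Lemma law_integral (f : T -> \bar R) : measurable_fun setT f ->
  \int[P]_w f (W w) = \int[m]_x f x.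
Proof.
move=> mf; rewrite -[LHS]/(\int[P]_w (f \o W) w) integralE [RHS]integralE.
congr (_ - _).
  under eq_integral do rewrite funepos_comp/=.
  by rewrite law_ge0_integral//; exact: measurable_funepos.
under eq_integral do rewrite funeneg_comp/=.
by rewrite law_ge0_integral//; exact: measurable_funeneg.
Qed.

Lemma law_integrable (f : T -> \bar R) : measurable_fun setT f ->
  P.-integrable setT (f \o W) <-> m.-integrable setT f.
Proof.
move=> mf; have mfW : measurable_fun setT (f \o W) by exact: measurableT_comp.
have E : \int[P]_w `|f (W w)| = \int[m]_x `|f x|.
  by apply: law_ge0_integral => //; exact: measurableT_comp.
by split=> /integrableP[_ foo]; apply/integrableP; split => //; move: foo;
  rewrite /= E.
Qed.

End transfer.

Section iid.
Context {R : realType} {d dU : measure_display} {Omega : measurableType d}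
  {U : measurableType dU}.
Variables (P : probability Omega R) (nu : probability U R).
Variable Z : nat -> {RV P >-> U}.
Hypothesis lawZ : forall i A, measurable A -> P (Z i @^-1` A) = nu A.
Hypothesis indZ : mutually_independent Z.
Local Open Scope ereal_scope.

Lemma iid_rectangle (i j k l : nat) (A B C D : set U) : uniq [:: i; j; k; l] ->
  measurable A -> measurable B -> measurable C -> measurable D ->
  P (Z i @^-1` A `&` (Z j @^-1` B `&` (Z k @^-1` C `&` Z l @^-1` D))) =
  nu A * (nu B * (nu C * nu D)).
Proof.
move=> u mA mB mC mD.
(* The default [D] serves [l] and all other indices; independence is applied to the four given
   indices only. *)
pose F n := if n == i then A else if n == j then B else if n == k then C else D.
have mF n : measurable (F n) by rewrite /F; do 3 case: ifP => // _.
have [Fi Fj Fk Fl] : [/\ F i = A, F j = B, F k = C & F l = D].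
  move: u; rewrite /= !inE !negb_or /F !eqxx.
  move=> /and4P[/and3P[ij ik il] /andP[jk jl] kl _].
  by rewrite (eq_sym j i) (eq_sym k i) (eq_sym l i) (eq_sym k j) (eq_sym l j)
    (eq_sym l k) (negbTE ij) (negbTE ik)
    (negbTE il) (negbTE jk) (negbTE jl) (negbTE kl).
have := indZ [fset i; j; k; l]%fset mF.
rewrite (perm_big [:: i; j; k; l])/=; last first.
  by apply: uniq_perm => [|//|x]; [exact: fset_uniq|rewrite !inE -!orbA].
rewrite !big_cons big_nil mule1 !Fi !Fj !Fk !Fl !lawZ// => <-; congr (P _).
apply/seteqP; split => [w /= [ZA [ZB [ZC ZD]]] n/=|w /= H].
  by rewrite !inE => /orP[/orP[/orP[]|]|] /eqP ->; rewrite ?Fi ?Fj ?Fk ?Fl.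
have {}H n : n \in [:: i; j; k; l] -> F n (Z n w).
  by move=> ns; apply: H => /=; move: ns; rewrite !inE -!orbA.
by rewrite -Fi -Fj -Fk -Fl; split; [|split; [|split]]; apply: H;
  rewrite !inE eqxx ?orbT.
Qed.

Local Notation pair k l := (fun w => (Z k w, Z l w)).
Local Notation triple j k l := (fun w => (Z j w, (Z k w, Z l w))).
Local Notation quad i j k l := (fun w => (Z i w, (Z j w, (Z k w, Z l w)))).

Lemma measurable_pair k l : measurable_fun setT (pair k l).
Proof. exact: measurable_fun_pair. Qed.

Lemma measurable_triple j k l : measurable_fun setT (triple j k l).
Proof. by apply: measurable_fun_pair => //; exact: measurable_pair. Qed.

Lemma measurable_quad i j k l : measurable_fun setT (quad i j k l).
Proof. by apply: measurable_fun_pair => //; exact: measurable_triple. Qed.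

Lemma law_quad_triple i j k l : uniq [:: i; j; k; l] ->
  (forall A C, measurable A -> measurable C ->
    P (Z i @^-1` A `&` triple j k l @^-1` C) =
      nu A * (prod_law nu (prod_law nu nu)) C).
Proof.
have mZ n (X : set U) : measurable X -> measurable (Z n @^-1` X).
  by move=> mX; exact: measurable_funPTI.
move=> u A C mA mC; rewrite -(lawZ i)//.
apply: (pair_law (m2 := prod_law nu nu)) => //;
  [exact: mZ|exact: measurable_pair|].
move=> B {}C mB {}mC; rewrite (lawZ i)// muleA.
have PAB : P (Z i @^-1` A `&` Z j @^-1` B) = nu A * nu B.
  have := iid_rectangle u mA mB measurableT measurableT.
  by rewrite !preimage_setT !setIT probability_setT !mule1.
rewrite setIA -PAB; apply: pair_law => //; first by apply: measurableI;
  exact: mZ.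
by move=> B1 B2 mB1 mB2; rewrite PAB -setIA iid_rectangle// muleA.
Qed.

Lemma law_triple i j k l : uniq [:: i; j; k; l] -> forall C, measurable C ->
  P (triple j k l @^-1` C) = (prod_law nu (prod_law nu nu)) C.
Proof.
move=> u C mC; have := law_quad_triple u measurableT mC.
by rewrite preimage_setT setTI probability_setT mul1e.
Qed.

Lemma law_quad i j k l : uniq [:: i; j; k; l] -> forall C, measurable C ->
  P (quad i j k l @^-1` C) = (prod_law nu (prod_law nu (prod_law nu nu))) C.
Proof.
move=> u C mC; rewrite -[_ @^-1` _]setTI -[RHS]mul1e -(probability_setT P).
apply: pair_law => //; first exact: measurable_triple.
by move=> A B mA mB; rewrite setTI law_quad_triple// probability_setT mul1e.
Qed.

Lemma law_pair i j k l : uniq [:: i; j; k; l] -> forall C, measurable C ->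
  P (pair k l @^-1` C) = prod_law nu nu C.
Proof.
move=> u C mC; have := law_triple u (measurableX measurableT mC).
have -> : prod_law nu (prod_law nu nu) (setT `*` C) = prod_law nu nu C.
  by rewrite [LHS]product_measure1E//= probability_setT mul1e.
by move=> <-; congr (P _); apply/seteqP; split=> w //= [].
Qed.

Lemma exchangeable (i j k l i' j' k' l' : nat) (F : U * (U * (U * U)) -> R) :
  uniq [:: i; j; k; l] -> uniq [:: i'; j'; k'; l'] -> measurable_fun setT F ->
  (\int[P]_w F (quad i j k l w) = \int[P]_w F (quad i' j' k' l' w))%R.
Proof.
move=> u u' mF; have mF' : measurable_fun setT (EFin \o F)
  by exact/measurable_EFinP.
have E a b c e : uniq [:: a; b; c; e] -> \int[P]_w (F (quad a b c e w))%:E =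
    \int[prod_law nu (prod_law nu (prod_law nu nu))]_z (F z)%:E.
  by move=> v; rewrite -(law_integral (measurable_quad a b c e)
    (law_quad v) mF').
by rewrite /Rintegral (E i j k l)// (E i' j' k' l').
Qed.

(** Under the fourfold product law [F] is constant in the first variable. Since every slice of [phi]
    is integrable, [F] leaves the inner integral at every point, not just almost everywhere. *)
Lemma integrate_out (i j k l : nat) (phi : U * U -> R) (F : U * (U * U) -> R) :
  uniq [:: i; j; k; l] -> measurable_fun setT phi ->
  (forall v, nu.-integrable setT (fun u => (phi (u, v))%:E)) ->
  measurable_fun setT F ->
  has_finite_expectation P
    (fun w => phi (Z i w, Z j w) * F (triple j k l w))%R ->
  (\int[P]_w (phi (Z i w, Z j w) * F (triple j k l w)) =
   \int[P]_w ((\int[nu]_u phi (u, Z j w)) * F (triple j k l w)))%R.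
Proof.
move=> u mphi iphi mF iG; rewrite /Rintegral; congr fine.
pose G z := ((phi (z.1, z.2.1) * F z.2)%R)%:E.
have mG : measurable_fun setT G.
  apply/measurable_EFinP; apply: measurable_funM; last exact: measurableT_comp.
  apply: (measurableT_comp mphi); apply: measurable_fun_pair => //.
  exact: measurableT_comp.
have {}iG : (prod_law nu (prod_law nu (prod_law nu nu))).-integrable setT G.
  by rewrite -(law_integrable (measurable_quad i j k l) (law_quad u) mG).
rewrite -[LHS]/(\int[P]_w G (quad i j k l w)).
rewrite (law_integral (measurable_quad i j k l) (law_quad u) mG).
have [iG1 ->] := prod_law_Fubini iG.
rewrite -(law_integral (measurable_triple j k l) (law_triple u)
  (measurable_int _ iG1)).
apply: eq_integral => w _; rewrite /G /=.
under eq_integral do rewrite EFinM.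
by rewrite integralZr// EFinM; congr (_ * _);
  rewrite fineK// integrable_fin_num.
Qed.

(** Each copy occurs in one factor of the bound, so first-order integrability of [G] is enough. *)
Lemma iid_dominated (G : U -> R) (C : R) (f : Omega -> R) :
  nu.-integrable setT (EFin \o G) -> measurable_fun setT f ->
  (forall w, `|f w| <= C * (G (Z 0 w) * G (Z 1 w) * G (Z 2 w) * G (Z 3 w)))%R ->
  has_finite_expectation P f.
Proof.
move=> iG mf fG; have mG : measurable_fun setT G.
  by move: iG => /measurable_int/measurable_EFinP.
pose H z := ((G z.1 * (G z.2.1 * (G z.2.2.1 * G z.2.2.2)))%R)%:E.
have iH : (prod_law nu (prod_law nu (prod_law nu nu))).-integrable setT H.
  apply: (@prod_integrable _ _ _ _ _ nu _ G
    (fun z => G z.1 * (G z.2.1 * G z.2.2))%R iG).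
  apply: (@prod_integrable _ _ _ _ _ nu _ G (fun z => G z.1 * G z.2)%R iG).
  exact: prod_integrable.
have := (law_integrable (measurable_quad 0 1 2 3)
  (@law_quad 0%N 1%N 2%N 3%N isT)
  (measurable_int _ iH)).2 iH.
move=> /(integrableZl measurableT C); apply: le_integrable => //.
  exact/measurable_EFinP.
move=> w _; rewrite lee_fin; apply: le_trans (ler_norm _).
by have := fG w; rewrite -!mulrA.
Qed.

End iid.

(** * Centered kernels *)

Section finite_expectation.
Context {R : realType} {d : measure_display} {T : measurableType d}.
Variable P : probability T R.
Implicit Types (f g : T -> R) (c : R).
Local Notation L1 := (has_finite_expectation P).

Lemma finite_expectation_measurable f : L1 f -> measurable_fun setT f.
Proof. by move=> /measurable_int/measurable_EFinP. Qed.

Lemma finite_expectationD f g : L1 f -> L1 g -> L1 (fun x => f x + g x).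
Proof. by move=> fi gi; apply: eq_integrable (integrableD _ fi gi). Qed.

Lemma finite_expectationB f g : L1 f -> L1 g -> L1 (fun x => f x - g x).
Proof. by move=> fi gi; apply: eq_integrable (integrableB _ fi gi). Qed.

Lemma finite_expectationZ c f : L1 f -> L1 (fun x => c * f x).
Proof. by move=> fi; apply: eq_integrable (integrableZl _ c fi). Qed.

Lemma finite_expectation_cst c : L1 (fun=> c).
Proof. exact: finite_measure_integrable_cst. Qed.

Lemma Rintegral_probability_cst c : \int[P]_x c = c.
Proof.
rewrite Rintegral_cst// [X in fine X](_ : _ = 1%E) ?mulr1//.
exact: (probability_setT P).
Qed.

Lemma finite_expectation_le f g : measurable_fun setT f ->
  (forall x, `|f x| <= g x) -> L1 g -> L1 f.
Proof.
move=> mf fg; apply: le_integrable => //; first exact/measurable_EFinP.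
by move=> x _; rewrite lee_fin (le_trans (fg x))// ler_norm.
Qed.

End finite_expectation.

(** The square accounts for products of two dominated kernels, where each copy carries one weight
    from either kernel. *)
Definition weight {R : realType} {dU : measure_display} {U : measurableType dU}
    (nu : probability U R) (h : U -> R) : Prop :=
  [/\ measurable_fun setT h, forall x, 1 <= h x &
      has_finite_expectation nu (fun x => h x ^+ 2)].

Lemma weight_int {R : realType} {dU : measure_display} {U : measurableType dU}
    (nu : probability U R) (h : U -> R) :
  weight nu h -> has_finite_expectation nu h.
Proof.
move=> [mh h1 h2]; have h0 x : 0 <= h x by rewrite (le_trans ler01).
apply: finite_expectation_le mh _ h2 => x.
by rewrite ger0_norm// expr2 ler_peMr.
Qed.

(* A symmetric kernel k(u,v), in practice d(u,v)^alpha, with the weight h that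
   dominates its cycle sums. *)
Record centerable {R : realType} {d dU : measure_display}
    {Omega : measurableType d} {U : measurableType dU} (P : probability Omega R)
    (nu : probability U R) (Z : nat -> {RV P >-> U}) (k : U * U -> R)
    (h : U -> R) : Prop := {
  centerable_measurable : measurable_fun setT k ;
  centerable_sym : forall u v, k (u, v) = k (v, u) ;
  centerable_slice : forall v, has_finite_expectation nu (fun u => k (u, v)) ;
  centerable_int : has_finite_expectation P (fun w => k (Z 0 w, Z 1 w)) ;
  centerable_weight : weight nu h ;
  centerable_cycle : exists2 C, 0 <= C & forall x0 x1 x2 x3,
    `|k (x0, x1) - k (x1, x2) + k (x2, x3) - k (x3, x0)|
      <= C * (h x0 * h x1 * h x2 * h x3) }.

Section kernel.
Context {R : realType} {d dU : measure_display} {Omega : measurableType d}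
  {U : measurableType dU}.
Variables (P : probability Omega R) (nu : probability U R).
Variable Z : nat -> {RV P >-> U}.
Hypothesis lawZ : forall i A, measurable A -> P (Z i @^-1` A) = nu A.
Hypothesis indZ : mutually_independent Z.
Local Notation L1 := (has_finite_expectation P).

Variables (k : U * U -> R) (h : U -> R).
Hypothesis kh : centerable nu Z k h.
Let mk := centerable_measurable kh.
Let k_sym := centerable_sym kh.
Let k_slice := centerable_slice kh.
Let k_int := centerable_int kh.
Let k_cycle := centerable_cycle kh.

Definition kernel_mean (v : U) : R := \int[nu]_u k (u, v).

Definition kernel_avg : R := \int[P]_w k (Z 0 w, Z 1 w).

Definition centered (z : U * U) : R :=
  k z - kernel_mean z.1 - kernel_mean z.2 + kernel_avg.

Let kernel_mean_facts : has_finite_expectation nu kernel_mean /\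
  kernel_avg = \int[nu]_v kernel_mean v.
Proof.
have mk' : measurable_fun setT (EFin \o k) by exact/measurable_EFinP.
have lawp := law_pair lawZ indZ (isT : uniq [:: 2; 3; 0; 1]%N).
have := (law_integrable (measurable_pair Z 0 1) lawp mk').1 k_int.
move=> /prod_law_Fubini[im Em].
have E v : (\int[nu]_u (k (u, v))%:E = (kernel_mean v)%:E)%E.
  by rewrite /kernel_mean /Rintegral fineK// integrable_fin_num// k_slice.
split; first by apply: eq_integrable im => // v _; rewrite /= E.
rewrite /kernel_avg /Rintegral; congr fine.
rewrite -[LHS]/(\int[P]_w (EFin \o k) (Z 0 w, Z 1 w))%E.
rewrite (law_integral (measurable_pair Z 0 1) lawp mk') Em.
by apply: eq_integral => v _; rewrite /= E.
Qed.

Lemma kernel_mean_int : has_finite_expectation nu kernel_mean.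
Proof. by have [] := kernel_mean_facts. Qed.

Lemma kernel_avgE : kernel_avg = \int[nu]_v kernel_mean v.
Proof. by have [] := kernel_mean_facts. Qed.

Lemma measurable_kernel_mean : measurable_fun setT kernel_mean.
Proof. exact: finite_expectation_measurable kernel_mean_int. Qed.

Lemma measurable_centered : measurable_fun setT centered.
Proof.
apply: measurable_funD => //; apply: measurable_funB; last first.
  exact: (measurableT_comp measurable_kernel_mean).
apply: measurable_funB => //.
exact: (measurableT_comp measurable_kernel_mean).
Qed.

Lemma centered_sym u v : centered (u, v) = centered (v, u).
Proof. by rewrite /centered /= k_sym; ring. Qed.

Lemma centered_slice v : has_finite_expectation nu (fun u => centered (u, v)).
Proof.
rewrite /centered /=; apply: finite_expectationD;
  last exact: finite_expectation_cst.
apply: finite_expectationB; last exact: finite_expectation_cst.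
by apply: finite_expectationB; [exact: k_slice|exact: kernel_mean_int].
Qed.

Lemma centered_mean0 v : \int[nu]_u centered (u, v) = 0.
Proof.
have i1 := finite_expectationB (k_slice v) kernel_mean_int.
have c r := finite_expectation_cst nu r.
have i2 := finite_expectationB i1 (c (kernel_mean v)).
rewrite /centered /= (RintegralD measurableT i2 (c kernel_avg)).
rewrite (RintegralB measurableT i1 (c _)).
rewrite (RintegralB measurableT (k_slice v) kernel_mean_int).
rewrite !Rintegral_probability_cst -kernel_avgE.
by rewrite -/(kernel_mean v); ring.
Qed.

Lemma centered_cycle x0 x1 x2 x3 :
  k (x0, x1) - k (x1, x2) + k (x2, x3) - k (x3, x0) =
  centered (x0, x1) - centered (x1, x2) + centered (x2, x3) - centered (x3, x0).
Proof. by rewrite /centered /=; ring. Qed.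

Lemma iid_slice (f : U * U -> R) i v : measurable_fun setT f ->
  has_finite_expectation nu (fun u => f (u, v)) ->
  L1 (fun w => f (Z i w, v)) /\ \int[P]_w f (Z i w, v) = \int[nu]_u f (u, v).
Proof.
move=> mf fi; have mfv : measurable_fun setT (EFin \o (fun u => f (u, v))).
  exact: measurable_int fi.
split; first exact: (law_integrable (measurable_funPT (Z i)) (lawZ i) mfv).2 fi.
rewrite /Rintegral; congr fine.
exact: (law_integral (measurable_funPT (Z i)) (lawZ i) mfv).
Qed.

(** Bounding the four terms separately would lose the cancellation. Instead [centered (u, v)] is the
    mean of the cycle sum over u, v, Z 0, Z 1 with u and v fixed, so it inherits the bound on cycle
    sums; the constant gains the mean of the two weights integrated out. *)
Lemma centered_bound : exists2 C, 0 <= C &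
  forall u v, `|centered (u, v)| <= C * (h u * h v).
Proof.
have [C C0 kC] := k_cycle; have [mh h_ge1 _] := centerable_weight kh.
have h0 x : 0 <= h x by rewrite (le_trans ler01).
have h_int := weight_int (centerable_weight kh).
have hh : L1 (fun w => h (Z 0 w) * h (Z 1 w)).
  apply: (iid_dominated lawZ indZ (C := 1) h_int).
    by apply: measurable_funM; exact: measurableT_comp.
  move=> w; rewrite mul1r ger0_norm ?mulr_ge0//.
  by rewrite -[leRHS]mulrA ler_peMr ?mulr_ge0// mulr_ege1.
exists (C * \int[P]_w (h (Z 0 w) * h (Z 1 w))).
  by rewrite mulr_ge0 ?Rintegral_ge0// => w _; rewrite mulr_ge0.
move=> u v; have [iu Eu] := @iid_slice k 1%N u mk (k_slice u).
have [iv Ev] := @iid_slice k 0%N v mk (k_slice v).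
have c r := finite_expectation_cst P r.
pose f w := k (u, v) - k (Z 0 w, v) + k (Z 0 w, Z 1 w) - k (Z 1 w, u).
have f1 := finite_expectationB (c (k (u, v))) iv.
have f2 := finite_expectationD f1 k_int.
have fi : L1 f by exact: finite_expectationB f2 iu.
have -> : centered (u, v) = \int[P]_w f w.
  rewrite /f (RintegralB measurableT f2 iu) (RintegralD measurableT f1 k_int).
  rewrite (RintegralB measurableT (c _) iv) Eu Ev.
  rewrite Rintegral_probability_cst.
  by rewrite /centered /= -/(kernel_mean u) -/(kernel_mean v) -/kernel_avg;
    ring.
apply: le_trans (le_normr_Rintegral _ fi) _ => //.
have -> : C * (\int[P]_w (h (Z 0 w) * h (Z 1 w))) * (h u * h v) =
    \int[P]_w (C * (h u * h v) * (h (Z 0 w) * h (Z 1 w))).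
  by rewrite (RintegralZl _ measurableT hh); ring.
apply: le_Rintegral => //; first exact: integrable_norm.
  exact: finite_expectationZ.
move=> w _; rewrite /f (k_sym (Z 0 w) v).
apply: le_trans (kC u v (Z 0 w) (Z 1 w)) _.
by rewrite !mulrA.
Qed.

Lemma centered_integrate_out (i j l m : nat) (F : U * (U * U) -> R) :
  uniq [:: i; j; l; m] -> measurable_fun setT F ->
  L1 (fun w => centered (Z i w, Z j w) * F (Z j w, (Z l w, Z m w))) ->
  \int[P]_w (centered (Z i w, Z j w) * F (Z j w, (Z l w, Z m w))) = 0.
Proof.
move=> u mF iF.
rewrite (integrate_out lawZ indZ u measurable_centered centered_slice mF iF).
under eq_Rintegral do rewrite centered_mean0 mul0r.
exact: Rintegral_probability_cst.
Qed.

End kernel.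

(** * Products of two kernels and the covariance identities *)

Section two_kernels.
Context {R : realType} {d dU : measure_display} {Omega : measurableType d}
  {U : measurableType dU}.
Variables (P : probability Omega R) (nu : probability U R).
Variable Z : nat -> {RV P >-> U}.
Hypothesis lawZ : forall i A, measurable A -> P (Z i @^-1` A) = nu A.
Hypothesis indZ : mutually_independent Z.
Local Notation L1 := (has_finite_expectation P).
Local Notation cycle k := (fun w =>
  k (Z 0 w, Z 1 w) - k (Z 1 w, Z 2 w) + k (Z 2 w, Z 3 w) - k (Z 3 w, Z 0 w)).
Local Notation pair_dominated f h :=
  (exists2 C, 0 <= C & forall u v, `|f (u, v)| <= C * (h u * h v)).

(** At one copy the two weights are evaluated at the same point, so their product is bounded
    pointwise by [h ^+ 2 + g ^+ 2]; across copies independence takes over. *)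
Lemma weighted_int (h g : U -> R) (C : R) (f : Omega -> R) :
  weight nu h -> weight nu g -> 0 <= C -> measurable_fun setT f ->
  (forall w, `|f w| <= C * ((h (Z 0 w) * h (Z 1 w) * h (Z 2 w) * h (Z 3 w)) *
                            (g (Z 0 w) * g (Z 1 w) * g (Z 2 w) * g (Z 3 w)))) ->
  L1 f.
Proof.
move=> [mh h1 h2] [mg g1 g2] C0 mf fC.
apply: (iid_dominated lawZ indZ (finite_expectationD h2 g2) mf (C := C)) => w.
apply: le_trans (fC w) _; rewrite ler_wpM2l//.
have h0 x : 0 <= h x by rewrite (le_trans ler01).
have g0 x : 0 <= g x by rewrite (le_trans ler01).
have hg x : 0 <= h x * g x <= h x ^+ 2 + g x ^+ 2.
  by rewrite mulr_ge0//=; have := h0 x; have := g0 x; nra.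
rewrite [leLHS](_ : _ = (h (Z 0 w) * g (Z 0 w)) * (h (Z 1 w) * g (Z 1 w)) *
  (h (Z 2 w) * g (Z 2 w)) * (h (Z 3 w) * g (Z 3 w))); last by ring.
have /andP[? ?] := hg (Z 0 w); have /andP[? ?] := hg (Z 1 w).
have /andP[? ?] := hg (Z 2 w); have /andP[? ?] := hg (Z 3 w).
by rewrite !ler_pM ?mulr_ge0.
Qed.

(** [a] and [b] are the two indices missing from the pair; their weights are at least 1. *)
Lemma pair_le_quad (h : U -> R) (i j a b : nat) w : (forall x, 1 <= h x) ->
  perm_eq [:: i; j; a; b] [:: 0; 1; 2; 3]%N ->
  h (Z i w) * h (Z j w) <= h (Z 0 w) * h (Z 1 w) * h (Z 2 w) * h (Z 3 w).
Proof.
move=> h1 pq; have h0 x : 0 <= h x by rewrite (le_trans ler01).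
rewrite [leRHS](_ : _ = \prod_(n <- [:: 0; 1; 2; 3]%N) h (Z n w)); last first.
  by rewrite !big_cons big_nil mulr1 !mulrA.
rewrite -(perm_big _ pq) /= !big_cons big_nil mulr1 mulrA.
by rewrite ler_peMr ?mulr_ge0// mulr_ege1.
Qed.

Lemma measurable_at (k : U * U -> R) i j : measurable_fun setT k ->
  measurable_fun setT (fun w => k (Z i w, Z j w)).
Proof. by move=> mk; apply: (measurableT_comp mk);
  exact: measurable_fun_pair. Qed.

Lemma pair_prod_int (f e : U * U -> R) (h g : U -> R)
    (i j a b i' j' a' b' : nat) :
  perm_eq [:: i; j; a; b] [:: 0; 1; 2; 3]%N ->
  perm_eq [:: i'; j'; a'; b'] [:: 0; 1; 2; 3]%N ->
  weight nu h -> weight nu g ->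
  measurable_fun setT f -> measurable_fun setT e ->
  pair_dominated f h -> pair_dominated e g ->
  L1 (fun w => f (Z i w, Z j w) * e (Z i' w, Z j' w)).
Proof.
move=> p p' wh wg mf me [C C0 fC] [D D0 eD].
have [[_ h1 _] [_ g1 _]] := (wh, wg).
apply: (weighted_int wh wg (mulr_ge0 C0 D0)).
  by apply: measurable_funM; exact: measurable_at.
move=> w; rewrite normrM mulrACA ler_pM//.
  apply: le_trans (fC _ _) _.
  by rewrite ler_wpM2l// (pair_le_quad w h1 p).
apply: le_trans (eD _ _) _.
by rewrite ler_wpM2l// (pair_le_quad w g1 p').
Qed.

Section projection.
Variables (k : U * U -> R) (h : U -> R).
Hypothesis kh : centerable nu Z k h.
Local Notation c := (centered nu Z k).

(** Stated for a general test function because it serves twice: with an indicator it identifies the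
    conditional expectation, with the other centered kernel it evaluates the product of two cycle
    sums. *)
Lemma cycle_project (F : U * U -> R) (g : U -> R) : weight nu g ->
  measurable_fun setT F -> pair_dominated F g ->
  \int[P]_w (cycle k w * F (Z 0 w, Z 1 w)) =
  \int[P]_w (c (Z 0 w, Z 1 w) * F (Z 0 w, Z 1 w)).
Proof.
move=> wg mF Fg.
have mc := measurable_centered lawZ indZ kh.
have cb := centered_bound lawZ indZ kh.
have int_at i j a b : perm_eq [:: i; j; a; b] [:: 0; 1; 2; 3]%N ->
    L1 (fun w => c (Z i w, Z j w) * F (Z 0 w, Z 1 w)).
  move=> p; have wh := centerable_weight kh.
  exact: (pair_prod_int p (perm_refl [:: 0; 1; 2; 3]%N) wh wg mc mF cb Fg).
have I01 := int_at 0%N 1%N 2%N 3%N isT.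
have I12 := int_at 1%N 2%N 3%N 0%N isT.
have I21 := int_at 2%N 1%N 3%N 0%N isT.
have I23 := int_at 2%N 3%N 1%N 0%N isT.
have I30 := int_at 3%N 0%N 1%N 2%N isT.
(* The copy absent from [F] is [Z 2]; symmetry moves it to the first argument, the one integrated
   out. *)
have E12 : \int[P]_w (c (Z 1 w, Z 2 w) * F (Z 0 w, Z 1 w)) = 0.
  under eq_Rintegral do rewrite (centered_sym kh).
  apply: (@centered_integrate_out _ _ _ _ _ _ _ _ lawZ indZ _ _ kh 2 1 0 3
    (fun z => F (z.2.1, z.1))) => //.
  apply: (measurableT_comp mF); apply: measurable_fun_pair => //.
  exact: (measurableT_comp measurable_fst).
have E23 : \int[P]_w (c (Z 2 w, Z 3 w) * F (Z 0 w, Z 1 w)) = 0.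
  apply: (@centered_integrate_out _ _ _ _ _ _ _ _ lawZ indZ _ _ kh 2 3 0 1
    (fun z => F z.2)) => //.
  exact: (measurableT_comp mF).
have E30 : \int[P]_w (c (Z 3 w, Z 0 w) * F (Z 0 w, Z 1 w)) = 0.
  apply: (@centered_integrate_out _ _ _ _ _ _ _ _ lawZ indZ _ _ kh 3 0 1 2
    (fun z => F (z.1, z.2.1))) => //.
  apply: (measurableT_comp mF); apply: measurable_fun_pair => //.
  exact: (measurableT_comp measurable_fst).
rewrite [LHS](_ : _ = \int[P]_w (c (Z 0 w, Z 1 w) * F (Z 0 w, Z 1 w)
  - c (Z 1 w, Z 2 w) * F (Z 0 w, Z 1 w) + c (Z 2 w, Z 3 w) * F (Z 0 w, Z 1 w)
  - c (Z 3 w, Z 0 w) * F (Z 0 w, Z 1 w))); last first.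
  by apply: eq_Rintegral => w _; rewrite (centered_cycle nu Z k); ring.
have J1 := finite_expectationB I01 I12.
have J2 := finite_expectationD J1 I23.
rewrite (RintegralB measurableT J2 I30) (RintegralD measurableT J1 I23).
by rewrite (RintegralB measurableT I01 I12) E12 E23 E30; ring.
Qed.

End projection.

Lemma kernel_mean_bound (k : U * U -> R) (h : U -> R) :
  centerable nu Z k h -> pair_dominated k h ->
  exists2 C, 0 <= C & forall v, `|kernel_mean nu k v| <= C * h v.
Proof.
move=> kh [C C0 kC]; have [_ h1 _] := centerable_weight kh.
have h0 x : 0 <= h x by rewrite (le_trans ler01).
have hi := weight_int (centerable_weight kh).
exists (C * \int[nu]_u h u) => [|v].
  by rewrite mulr_ge0// Rintegral_ge0.
have ki := centerable_slice kh v.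
apply: le_trans (le_normr_Rintegral measurableT ki) _.
rewrite [leRHS](_ : _ = \int[nu]_u (C * h v * h u)); last first.
  by rewrite (RintegralZl _ measurableT hi); ring.
apply: le_Rintegral => //; first exact: integrable_norm.
  exact: finite_expectationZ.
by move=> u _; rewrite mulrAC -mulrA.
Qed.

Section covariances.
Variables (k l : U * U -> R) (h g : U -> R).
Hypotheses (kh : centerable nu Z k h) (lg : centerable nu Z l g).
Local Notation c := (centered nu Z k).
Local Notation e := (centered nu Z l).

Lemma measurable_cycle (f : U * U -> R) : measurable_fun setT f ->
  measurable_fun setT (cycle f).
Proof.
move=> mf; apply: measurable_funB; last exact: measurable_at.
apply: measurable_funD; last exact: measurable_at.
by apply: measurable_funB; exact: measurable_at.
Qed.

Lemma cycle_prod_int : L1 (fun w => cycle k w * cycle l w).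
Proof.
have [[C C0 kC] [D D0 lD]] := (centerable_cycle kh, centerable_cycle lg).
apply: (weighted_int (centerable_weight kh) (centerable_weight lg)
  (mulr_ge0 C0 D0)).
  apply: measurable_funM; apply: measurable_cycle.
    exact: centerable_measurable kh.
  exact: centerable_measurable lg.
by move=> w; rewrite normrM mulrACA ler_pM.
Qed.

Lemma centered_prod_int : L1 (fun w => c (Z 0 w, Z 1 w) * e (Z 0 w, Z 1 w)).
Proof.
apply: (@pair_prod_int _ _ h g 0 1 2 3 0 1 2 3) => //.
- exact: centerable_weight kh.
- exact: centerable_weight lg.
- exact: measurable_centered kh.
- exact: measurable_centered lg.
- exact: centered_bound kh.
- exact: centered_bound lg.
Qed.

(* Shifting the indices cyclically changes the sign of the cycle sum, so each of
   the four terms of the second factor contributes the same amount. *)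
Lemma cycle_prodE : \int[P]_w (cycle k w * cycle l w) =
  4 * \int[P]_w (c (Z 0 w, Z 1 w) * e (Z 0 w, Z 1 w)).
Proof.
have mk := centerable_measurable kh.
have me := measurable_centered lawZ indZ lg.
have wg := centerable_weight lg; have [_ g1 _] := wg.
have [D D0 eD] := centered_bound lawZ indZ lg.
have [C C0 kC] := centerable_cycle kh.
have int_at i j a b : perm_eq [:: i; j; a; b] [:: 0; 1; 2; 3]%N ->
    L1 (fun w => cycle k w * e (Z i w, Z j w)).
  move=> p; apply: (weighted_int (centerable_weight kh) wg (mulr_ge0 C0 D0)).
    by apply: measurable_funM; [exact: measurable_cycle|exact: measurable_at].
  move=> w; rewrite normrM mulrACA ler_pM//; apply: le_trans (eD _ _) _.
  by rewrite ler_wpM2l// (pair_le_quad w g1 p).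
have I01 := int_at 0%N 1%N 2%N 3%N isT.
have I12 := int_at 1%N 2%N 3%N 0%N isT.
have I23 := int_at 2%N 3%N 1%N 0%N isT.
have I30 := int_at 3%N 0%N 1%N 2%N isT.
have E : \int[P]_w (cycle k w * e (Z 0 w, Z 1 w)) =
    \int[P]_w (c (Z 0 w, Z 1 w) * e (Z 0 w, Z 1 w)).
  by apply: cycle_project kh _ _ wg me _; exists D.
(* The integrand as a function of four free points: at a rotated quadruple it is the cycle sum, up
   to sign, times [e] at the shifted pair. *)
pose Phi (z : U * (U * (U * U))) := (k (z.1, z.2.1) - k (z.2.1, z.2.2.1)
  + k (z.2.2.1, z.2.2.2) - k (z.2.2.2, z.1)) * e (z.1, z.2.1).
have mPhi : measurable_fun setT Phi.
  have m1 : measurable_fun setT (fun z : U * (U * (U * U)) => z.2.1).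
    exact: (measurableT_comp measurable_fst).
  have m2 : measurable_fun setT (fun z : U * (U * (U * U)) => z.2.2.1).
    by apply: (measurableT_comp measurable_fst);
      exact: (measurableT_comp measurable_snd).
  have m3 : measurable_fun setT (fun z : U * (U * (U * U)) => z.2.2.2).
    by apply: (measurableT_comp measurable_snd);
      exact: (measurableT_comp measurable_snd).
  apply: measurable_funM; last by apply: (measurableT_comp me);
    exact: measurable_fun_pair.
  apply: measurable_funB; last by apply: (measurableT_comp mk);
    exact: measurable_fun_pair.
  apply: measurable_funD; last by apply: (measurableT_comp mk);
    exact: measurable_fun_pair.
  by apply: measurable_funB; apply: (measurableT_comp mk);
    exact: measurable_fun_pair.
have X a b i j := @exchangeable _ _ _ _ _ P nu Z lawZ indZ a b i j
  0%N 1%N 2%N 3%N Phi.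
have E12 : \int[P]_w (cycle k w * e (Z 0 w, Z 1 w)) =
    -1 * \int[P]_w (cycle k w * e (Z 1 w, Z 2 w)).
  rewrite -(RintegralZl _ measurableT I12).
  apply: etrans (esym (X 1%N 2%N 3%N 0%N isT isT mPhi)) _.
  by apply: eq_Rintegral => w _; rewrite /Phi/=; ring.
have E23 : \int[P]_w (cycle k w * e (Z 0 w, Z 1 w)) =
    \int[P]_w (cycle k w * e (Z 2 w, Z 3 w)).
  apply: etrans (esym (X 2%N 3%N 0%N 1%N isT isT mPhi)) _.
  by apply: eq_Rintegral => w _; rewrite /Phi/=; ring.
have E30 : \int[P]_w (cycle k w * e (Z 0 w, Z 1 w)) =
    -1 * \int[P]_w (cycle k w * e (Z 3 w, Z 0 w)).
  rewrite -(RintegralZl _ measurableT I30).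
  apply: etrans (esym (X 3%N 0%N 1%N 2%N isT isT mPhi)) _.
  by apply: eq_Rintegral => w _; rewrite /Phi/=; ring.
rewrite [LHS](_ : _ = \int[P]_w (cycle k w * e (Z 0 w, Z 1 w)
  - cycle k w * e (Z 1 w, Z 2 w) + cycle k w * e (Z 2 w, Z 3 w)
  - cycle k w * e (Z 3 w, Z 0 w))); last first.
  by apply: eq_Rintegral => w _; rewrite (centered_cycle nu Z l); ring.
have J1 := finite_expectationB I01 I12.
have J2 := finite_expectationD J1 I23.
rewrite (RintegralB measurableT J2 I30) (RintegralD measurableT J1 I23).
rewrite (RintegralB measurableT I01 I12) -E.
by move: E12 E23 E30; lra.
Qed.

(* Expanding the second factor, only l survives, since the means of l depend on
   at most one of the two arguments; the means of k are then undone by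
   integrating out. *)
Lemma centered_prodE : pair_dominated k h -> pair_dominated l g ->
  \int[P]_w (c (Z 0 w, Z 1 w) * e (Z 0 w, Z 1 w)) =
  \int[P]_w (k (Z 0 w, Z 1 w) * l (Z 0 w, Z 1 w))
  + (\int[P]_w k (Z 0 w, Z 1 w)) * (\int[P]_w l (Z 0 w, Z 1 w))
  - 2 * \int[P]_w (k (Z 0 w, Z 1 w) * l (Z 0 w, Z 2 w)).
Proof.
move=> kd ld.
have [mk ml] := (centerable_measurable kh, centerable_measurable lg).
have [wh wg] := (centerable_weight kh, centerable_weight lg).
have mc := measurable_centered lawZ indZ kh.
have cb := centered_bound lawZ indZ kh.
have a_meas := measurable_kernel_mean lawZ indZ kh.
have b_meas := measurable_kernel_mean lawZ indZ lg.
have fst_dom (f : U -> R) (q : U -> R) : weight nu q ->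
    (exists2 C, 0 <= C & forall v, `|f v| <= C * q v) ->
    pair_dominated (fun z : U * U => f z.1) q /\
    pair_dominated (fun z : U * U => f z.2) q.
  move=> [_ q1 _] [C C0 fC]; have q0 x : 0 <= q x by rewrite (le_trans ler01).
  split; exists C => // u v /=; apply: le_trans (fC _) _; rewrite ler_wpM2l//.
    by rewrite ler_peMr.
  by rewrite ler_peMl.
have cst_dom (r : R) (q : U -> R) : weight nu q ->
    pair_dominated (fun=> r : R) q.
  move=> [_ q1 _]; exists `|r| => // u v; rewrite ler_peMr//.
  exact: mulr_ege1.
pose a := kernel_mean nu k; pose b := kernel_mean nu l.
pose m := kernel_avg Z k; pose n := kernel_avg Z l.
have [a1d a2d] := fst_dom a h wh (kernel_mean_bound kh kd).
have [b1d b2d] := fst_dom b g wg (kernel_mean_bound lg ld).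
have ma1 : measurable_fun setT (fun z : U * U => a z.1)
  by exact: measurableT_comp.
have ma2 : measurable_fun setT (fun z : U * U => a z.2)
  by exact: measurableT_comp.
have mb1 : measurable_fun setT (fun z : U * U => b z.1)
  by exact: measurableT_comp.
have mb2 : measurable_fun setT (fun z : U * U => b z.2)
  by exact: measurableT_comp.
have int01 (f q : U * U -> R) :
    measurable_fun setT f -> measurable_fun setT q ->
    pair_dominated f h -> pair_dominated q g ->
    L1 (fun w => f (Z 0 w, Z 1 w) * q (Z 0 w, Z 1 w)).
  exact: (@pair_prod_int f q h g 0 1 2 3 0 1 2 3 isT isT wh wg).
have cl := int01 _ _ mc ml cb ld.
have cb1 := int01 _ _ mc mb1 cb b1d.
have cb2 := int01 _ _ mc mb2 cb b2d.
have cn := int01 _ _ mc (measurable_cst n) cb (cst_dom n _ wg).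
(* Multiplied by [b (Z 0 w)], the centered kernel is alone in containing [Z 1]; multiplied by
   [b (Z 1 w)], it is alone in containing [Z 0]. *)
have E1 : \int[P]_w (c (Z 0 w, Z 1 w) * b (Z 0 w)) = 0.
  under eq_Rintegral do rewrite (centered_sym kh).
  apply: (@centered_integrate_out _ _ _ _ _ _ _ _ lawZ indZ _ _ kh 1 0 2 3
    (fun z => b z.1)) => //.
    exact: measurableT_comp.
  by apply: eq_integrable cb1 => // w _; rewrite /= (centered_sym kh).
have E2 : \int[P]_w (c (Z 0 w, Z 1 w) * b (Z 1 w)) = 0.
  apply: (@centered_integrate_out _ _ _ _ _ _ _ _ lawZ indZ _ _ kh 0 1 2 3
    (fun z => b z.1)) => //.
  exact: measurableT_comp.
have E3 : \int[P]_w (c (Z 0 w, Z 1 w) * n) = 0.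
  exact: (@centered_integrate_out _ _ _ _ _ _ _ _ lawZ indZ _ _ kh 0 1 2 3
    (fun=> n)).
rewrite [LHS](_ : _ = \int[P]_w (c (Z 0 w, Z 1 w) * l (Z 0 w, Z 1 w)
  - c (Z 0 w, Z 1 w) * b (Z 0 w) - c (Z 0 w, Z 1 w) * b (Z 1 w)
  + c (Z 0 w, Z 1 w) * n)); last first.
  by apply: eq_Rintegral => w _; rewrite [e _]/centered -/a -/b -/n /=; ring.
have J1 := finite_expectationB cl cb1.
have J2 := finite_expectationB J1 cb2.
rewrite (RintegralD measurableT J2 cn) (RintegralB measurableT J1 cb2).
rewrite (RintegralB measurableT cl cb1) E1 E2 E3 !subr0 addr0.
have kl := int01 _ _ mk ml kd ld.
have a1l := int01 _ _ ma1 ml a1d ld.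
have a2l := int01 _ _ ma2 ml a2d ld.
rewrite [LHS](_ : _ = \int[P]_w (k (Z 0 w, Z 1 w) * l (Z 0 w, Z 1 w)
  - a (Z 0 w) * l (Z 0 w, Z 1 w) - a (Z 1 w) * l (Z 0 w, Z 1 w)
  + m * l (Z 0 w, Z 1 w))); last first.
  by apply: eq_Rintegral => w _; rewrite /centered -/a -/m /=; ring.
have li := centerable_int lg.
have K1 := finite_expectationB kl a1l.
have K2 := finite_expectationB K1 a2l.
rewrite (RintegralD measurableT K2 (finite_expectationZ m li)).
rewrite (RintegralB measurableT K1 a2l) (RintegralB measurableT kl a1l).
rewrite (RintegralZl _ measurableT li) -/m.
pose Phi (z : U * (U * (U * U))) := a z.1 * l (z.1, z.2.1).
have mPhi : measurable_fun setT Phi.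
  apply: measurable_funM; first exact: measurableT_comp.
  apply: (measurableT_comp ml); apply: measurable_fun_pair => //.
  exact: (measurableT_comp measurable_fst).
have A1 : \int[P]_w (a (Z 1 w) * l (Z 0 w, Z 1 w)) =
    \int[P]_w (a (Z 0 w) * l (Z 0 w, Z 1 w)).
  under eq_Rintegral do rewrite (centerable_sym lg).
  exact: (@exchangeable _ _ _ _ _ P nu Z lawZ indZ 1 0 2 3 0 1 2 3 Phi).
(* Integrating out [Z 1] turns [k] into its mean at [Z 0], and [Z 2] is then renamed. The resulting
   integral is also that of both mixed terms, by [A1], whence the factor 2 in dcov^*. *)
have A2 : \int[P]_w (k (Z 0 w, Z 1 w) * l (Z 0 w, Z 2 w)) =
    \int[P]_w (a (Z 0 w) * l (Z 0 w, Z 1 w)).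
  under eq_Rintegral do rewrite (centerable_sym kh).
  rewrite (@integrate_out _ _ _ _ _ P nu Z lawZ indZ 1 0 2 3 k
    (fun z => l (z.1, z.2.1)) isT mk (centerable_slice kh)).
  - exact: (@exchangeable _ _ _ _ _ P nu Z lawZ indZ 0 2 1 3 0 1 2 3 Phi).
  - apply: (measurableT_comp ml); apply: measurable_fun_pair => //.
    exact: (measurableT_comp measurable_fst).
  - exact: (@pair_prod_int k l h g 1 0 2 3 0 2 1 3 isT isT wh wg).
by rewrite A1 A2 /m /kernel_avg; ring.
Qed.

End covariances.

End two_kernels.

(** * Conditional expectation and distance kernels *)

Section conditional_expectation.
Context {R : realType} {d d' : measure_display} {Omega : measurableType d}
  {T : measurableType d'}.
Variables (P : probability Omega R) (f : Omega -> T).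
Hypothesis mf : measurable_fun setT f.
Local Notation G := (g_sigma_algebra_preimage f).
Local Notation OmegaG := (g_sigma_algebra_preimageType f).

(* The two versions are compared on Omega equipped with the sub-sigma-algebra
   only, where equality of all integrals gives equality almost everywhere. *)
Lemma is_condexp_unique (X g1 g2 : Omega -> R) :
  is_condexp P G X g1 -> is_condexp P G X g2 -> ae_eq P setT g1 g2.
Proof.
move=> [_ i1 m1 e1] [_ i2 m2 e2].
have Gm A : G A -> measurable A.
  by move=> [B mB <-]; rewrite -[X in measurable X]setTI setTI; exact: mf.
have mid : measurable_fun [set: Omega] (id : Omega -> OmegaG).
  by move=> _ B GB; rewrite setTI; exact: Gm.
(* The identity is measurable into the coarser space, and pushing [P] forward along it restricts [P]
   to the sub-sigma-algebra. *)
have [m mE] : exists m : {measure set OmegaG -> \bar R}, forall A, m A = P A.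
  by unshelve eexists (pushforward P (id : Omega -> OmegaG)).
have mg (g : Omega -> R) : (forall B : set R, measurable B -> G (g @^-1` B)) ->
    measurable_fun [set: OmegaG] (EFin \o g : OmegaG -> \bar R).
  move=> Gg; apply/measurable_EFinP => _ B mB; rewrite setTI; exact: Gg.
have mint A (g : Omega -> R) : G A ->
    measurable_fun [set: OmegaG] (EFin \o g : OmegaG -> \bar R) ->
    has_finite_expectation P g ->
    (\int[m]_(w in A) (g w)%:E = \int[P]_(w in A) (g w)%:E)%E.
  move=> GA mG gi; have gA : P.-integrable A (EFin \o g).
    by apply: integrableS gi => //; exact: Gm.
  rewrite -[RHS](integral_pushforward mid mG gA GA).
  by apply: eq_measure_integral => B GB _; rewrite mE.
have gi (g : Omega -> R) :
    measurable_fun [set: OmegaG] (EFin \o g : OmegaG -> \bar R) ->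
    has_finite_expectation P g ->
    m.-integrable setT (EFin \o g : OmegaG -> \bar R).
  move=> mG gi; apply/integrableP; split => //.
  have /integrableP[_] := gi.
  have mG' : measurable_fun [set: OmegaG] (fun w : OmegaG => `|(g w)%:E|%E).
    exact: measurableT_comp.
  have := ge0_integral_pushforward mid P measurableT mG'
    (fun x _ => abse_ge0 _).
  rewrite preimage_setT => <-; apply: le_lt_trans.
  rewrite le_eqVlt; apply/orP; left; apply/eqP.
  by apply: eq_measure_integral => B GB _; rewrite mE.
have [A [GA mA sA]] : ae_eq m setT (EFin \o g1) (EFin \o g2).
  apply: integral_ae_eq => //; [exact: gi (mg _ m1) i1|exact: mg|].
  by move=> E _ GE; rewrite !mint//; [rewrite e1// e2|exact: mg|exact: mg].
exists A; split; [exact: Gm|by rewrite -mA mE|].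
by move=> w /= gw; apply: sA => /= gE; apply: gw => _; have [] := gE I.
Qed.

(** [condexp] chooses a version blindly; exhibiting one version makes the choice a genuine one, and
    uniqueness compares the two. *)
Lemma condexpP (X g : Omega -> R) : is_condexp P G X g ->
  is_condexp P G X (condexp P G X) /\ ae_eq P setT (condexp P G X) g.
Proof.
move=> Xg; have Xc : is_condexp P G X (condexp P G X).
  exact: (@xgetI _ (cst 0) [set g | is_condexp P G X g]) Xg.
by split => //; exact: is_condexp_unique Xc Xg.
Qed.

End conditional_expectation.

Section metric_kernel.
Context {R : realType} {d dU : measure_display} {Omega : measurableType d}
  {U : measurableType dU}.
Variables (P : probability Omega R) (nu : probability U R).
Variable Z : nat -> {RV P >-> U}.
Hypothesis lawZ : forall i A, measurable A -> P (Z i @^-1` A) = nu A.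
Hypothesis indZ : mutually_independent Z.
Local Notation L1 := (has_finite_expectation P).

Variables (M : pmetricType R) (o : M) (a : R).
Hypotheses (sepM : separable_space M) (a0 : 0 < a).
(** [pr] will be a coordinate of the pair space and [sec] a measurable right inverse that fills the
    other coordinate with a base point. Through [sec], a function on pairs that depends on [pr] only
    becomes a function on [M]. *)
Variables (pr : U -> borel M) (sec : borel M -> U).
Hypotheses (mpr : measurable_fun setT pr) (msec : measurable_fun setT sec).
Hypothesis prK : forall x, pr (sec x) = x.

Definition mdist_kernel (z : U * U) : R := mdist (pr z.1 : M) (pr z.2 : M) `^ a.
Local Notation k := mdist_kernel.
Local Notation V := (fun i => (pr \o Z i) : Omega -> M).
Local Notation wt q := (fun u : U => mdist_weight q o (pr u : M)).
Local Notation moment p :=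
  (has_finite_expectation nu (fun u : U => mdist (pr u : M) o `^ p)).

Lemma measurable_mdist_kernel : measurable_fun setT k.
Proof.
have mz : measurable_fun [set: U * U] (fun z => (pr z.1, pr z.2)).
  by apply: measurable_fun_pair; exact: measurableT_comp.
have mmd := measurableT_comp (measurable_mdist sepM) mz.
exact: (measurableT_comp (@measurable_powR R a) mmd).
Qed.

Lemma measurable_mdist_pow p :
  measurable_fun setT (fun u : U => mdist (pr u : M) o `^ p).
Proof.
have mmd := measurableT_comp (measurable_mdist_cst o) mpr.
exact: (measurableT_comp (@measurable_powR R p) mmd).
Qed.

Lemma mdist_kernel_sym u v : k (u, v) = k (v, u).
Proof. by rewrite /mdist_kernel metric_sym. Qed.

Lemma moment_le p q : 0 < p -> p <= q -> moment q -> moment p.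
Proof.
move=> p0 pq mq; have := finite_expectationD (finite_expectation_cst nu 1) mq.
apply: finite_expectation_le; first exact: measurable_mdist_pow.
move=> u; rewrite ger0_norm ?powR_ge0//; have r0 := mdist_ge0 (pr u : M) o.
have [x1|/ltW x1] := leP (mdist (pr u : M) o) 1; last first.
  by rewrite (le_trans (ler_powR x1 pq))// lerDr.
rewrite (@le_trans _ _ 1) ?lerDl ?powR_ge0//.
by have := ge0_ler_powR (ltW p0) r0 ler01 x1; rewrite powR1.
Qed.

Lemma weight_mdist q : 0 < q -> moment (2 * q) -> weight nu (wt q).
Proof.
move=> q0 mq; split.
- by apply: measurable_funD => //; exact: measurable_mdist_pow.
- by move=> x; exact: mdist_weight_ge1.
have := finite_expectationD (finite_expectation_cst nu 2)
  (finite_expectationZ 2 mq).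
apply: finite_expectation_le.
  by apply: measurable_funX; apply: measurable_funD => //;
    exact: measurable_mdist_pow.
move=> u; rewrite ger0_norm ?exprn_ge0 ?(le_trans ler01
  (mdist_weight_ge1 _ _ _))//.
rewrite /mdist_weight (mulrC 2 q) powRrM powR_mulrn ?powR_ge0//.
by have := sqr_ge0 (1 - mdist (pr u : M) o `^ q); nra.
Qed.

Lemma mdist_kernel_dominated :
  exists2 C, 0 <= C & forall u v, `|k (u, v)| <= C * (wt a u * wt a v).
Proof.
exists (2 `^ a) => [|u v]; first exact: powR_ge0.
by rewrite ger0_norm ?powR_ge0//; exact: mdist_pow_bound.
Qed.

(** Two exponents coexist. A single power is dominated with exponent [a], and [a <= 2 * q] makes
    that weight integrable, which yields the slices and the mean. The square-integrable weight of
    exponent [q] has to dominate cycle sums only. *)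
Lemma centerable_mdist_kernel q : 0 < q -> a <= 2 * q -> moment (2 * q) ->
  (exists2 C, 0 <= C & forall x0 x1 x2 x3,
    `|k (x0, x1) - k (x1, x2) + k (x2, x3) - k (x3, x0)|
      <= C * (wt q x0 * wt q x1 * wt q x2 * wt q x3)) ->
  centerable nu Z k (wt q).
Proof.
move=> q0 aq mq cyc; have ma := moment_le a0 aq mq.
have mk := measurable_mdist_kernel.
have wi : has_finite_expectation nu (wt a).
  exact: (finite_expectationD (finite_expectation_cst nu 1) ma).
have [C C0 kC] := mdist_kernel_dominated.
split => //; [exact: mdist_kernel_sym| | |exact: weight_mdist].
- move=> v; have := finite_expectationZ (C * wt a v) wi.
  apply: finite_expectation_le.
    by apply: (measurableT_comp mk); exact: measurable_fun_pair.
  by move=> u; rewrite (le_trans (kC u v))// mulrA mulrAC.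
- apply: (iid_dominated lawZ indZ wi (C := C)).
    by apply: (measurableT_comp mk); exact: measurable_fun_pair.
  move=> w; apply: le_trans (kC _ _) _; rewrite ler_wpM2l// -mulrA.
  have w1 x : 1 <= wt a x by exact: mdist_weight_ge1.
  have w0 x : 0 <= wt a x by rewrite (le_trans ler01).
  by rewrite ler_peMr ?mulr_ge0// mulr_ege1.
Qed.

(** With 2a moments the triangle inequality over the four terms suffices, hence the constant
    [4 * C]. *)
Lemma centerable_mdist_star : moment (2 * a) -> centerable nu Z k (wt a).
Proof.
move=> ma; apply: centerable_mdist_kernel => //; first by move: a0; lra.
have [C C0 kC] := mdist_kernel_dominated; exists (4 * C); first by lra.
move=> x0 x1 x2 x3; have w1 x : 1 <= wt a x by exact: mdist_weight_ge1.
have w0 x : 0 <= wt a x by rewrite (le_trans ler01).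
have key x y z t : `|k (x, y)| <= C * (wt a x * wt a y * (wt a z * wt a t)).
  by rewrite (le_trans (kC x y))// ler_wpM2l// ler_peMr ?mulr_ge0// mulr_ege1.
have := key x0 x1 x2 x3; have := key x1 x2 x3 x0.
have := key x2 x3 x0 x1; have := key x3 x0 x1 x2.
rewrite !ler_norml => /andP[? ?] /andP[? ?] /andP[? ?] /andP[? ?].
by apply/andP; split; lra.
Qed.

Lemma centerable_mdist_hat : moment (alpha_star a) ->
  centerable nu Z k (wt (alpha_star a / 2)).
Proof.
have as2 : 2 * (alpha_star a / 2) = alpha_star a by lra.
move=> ma; apply: centerable_mdist_kernel; rewrite ?as2//.
- by have [[_ ->]|[? ->]] := alpha_star_half a0; move: a0; lra.
- by rewrite /alpha_star le_max lexx.
have [C C0 kC] := mdist_pow_cycle_bound a0.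
by exists C => // *; exact: kC.
Qed.

Section tilde.
Variable h : U -> R.
Hypothesis kh : centerable nu Z k h.
Local Notation c := (centered nu Z k).

Lemma kernel_sec u v : k (sec (pr u), v) = k (u, v).
Proof. by rewrite /mdist_kernel /= prK. Qed.

(* The centered kernel depends on its arguments through pr only, which makes it
   measurable for the sigma-algebra generated by the projected pair. *)
Lemma centered_sec u v : c (sec (pr u), sec (pr v)) = c (u, v).
Proof.
have E x y : k (x, sec (pr y)) = k (x, y).
  by rewrite mdist_kernel_sym kernel_sec mdist_kernel_sym.
have Em y : kernel_mean nu k (sec (pr y)) = kernel_mean nu k y.
  by apply: eq_Rintegral => x _; rewrite E.
by rewrite /centered /= !Em E kernel_sec.
Qed.

Lemma dist_hat_int : L1 (dist_hat a V).
Proof.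
have [C C0 kC] := centerable_cycle kh.
apply: (iid_dominated lawZ indZ (weight_int (centerable_weight kh)) (C := C)).
  exact: (measurable_cycle Z (centerable_measurable kh)).
by move=> w; exact: kC.
Qed.

Lemma dist_tilde_finite_kernel : dist_tilde_finite P a V.
Proof.
split; [exact: dist_hat_int|exact: centerable_int kh|move=> u].
have sl := centerable_slice kh (sec u).
have [i0 _] := iid_slice lawZ 0%N (centerable_measurable kh) sl.
apply: eq_integrable i0 => // w _ /=.
by rewrite /dist_pow /mdist_kernel /= prK metric_sym.
Qed.

Let m_V01 : measurable_fun setT
  (fun w => (V 0%N w, V 1%N w) : borel M * borel M).
Proof.
by apply: measurable_fun_pair; apply: (measurableT_comp mpr).
Qed.

Lemma centered_is_condexp : is_condexp P (sigma_pair (V 0%N) (V 1%N))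
  (dist_hat a V) (fun w => c (Z 0%N w, Z 1%N w)).
Proof.
have wh := centerable_weight kh; have [_ h1 _] := wh.
have h0 x : 0 <= h x by rewrite (le_trans ler01).
have mc := measurable_centered lawZ indZ kh.
have [C C0 cC] := centered_bound lawZ indZ kh.
have ci : L1 (fun w => c (Z 0%N w, Z 1%N w)).
  apply: (iid_dominated lawZ indZ (weight_int wh) (C := C)).
    exact: measurable_at.
  move=> w; apply: le_trans (cC _ _) _; rewrite ler_wpM2l// -mulrA.
  by rewrite ler_peMr ?mulr_ge0// mulr_ege1.
split=> //; first exact: dist_hat_int.
  move=> B mB.
  exists ((fun z : borel M * borel M => c (sec z.1, sec z.2)) @^-1` B).
    rewrite -[X in measurable X]setTI.
    have ms : measurable_fun setT
        (fun z : borel M * borel M => (sec z.1, sec z.2)).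
      by apply: measurable_fun_pair; exact: measurableT_comp.
    exact: (measurableT_comp mc ms).
  by rewrite setTI; apply/seteqP; split => w /=; rewrite centered_sec.
move=> _ [B mB <-]; rewrite setTI.
(* An event of the generated sigma-algebra becomes a test function of the pair; its bound 1 lies
   below any product of weights. *)
pose F (z : U * U) : R := \1_B ((pr z.1, pr z.2) : borel M * borel M).
have mF : measurable_fun setT F.
  have mz : measurable_fun [set: U * U] (fun z => (pr z.1, pr z.2)).
    by apply: measurable_fun_pair; exact: measurableT_comp.
  exact: (measurableT_comp (measurable_indic mB) mz).
have F1 u v : `|F (u, v)| <= 1 by rewrite /F indicE; case: (_ \in _);
  rewrite ?normr1 ?normr0.
have Fd : exists2 C, 0 <= C & forall u v, `|F (u, v)| <= C * (h u * h v).
  by exists 1 => // u v; rewrite mul1r (le_trans (F1 u v))// mulr_ege1.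
have fiF (f : Omega -> R) : L1 f -> L1 (fun w => f w * F (Z 0%N w, Z 1%N w)).
  move=> fi; have mf := finite_expectation_measurable fi.
  apply: (finite_expectation_le (g := fun w => `|f w|)).
  - by apply: measurable_funM => //; exact: measurable_at.
  - by move=> w; rewrite normrM ler_piMr.
  - exact: integrable_norm.
have E (f : Omega -> R) : L1 f ->
    (\int[P]_(w in (fun w => (V 0%N w, V 1%N w)) @^-1` B) (f w)%:E =
     (\int[P]_w (f w * F (Z 0%N w, Z 1%N w)))%R%:E)%E.
  move=> fi; rewrite /Rintegral fineK; last first.
    exact: (integrable_fin_num _ (fiF f fi)).
  rewrite [LHS]integral_mkcond; apply: eq_integral => w _.
  rewrite patchE /F indicE /=.
  rewrite -[_ \in _ @^-1` B]/
    (((pr (Z 0%N w), pr (Z 1%N w)) : borel M * borel M) \in B).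
  by case: (_ \in B); rewrite ?mulr1 ?mulr0.
rewrite !E//; last exact: dist_hat_int.
by rewrite -(cycle_project lawZ indZ kh wh mF Fd).
Qed.

Lemma dist_tilde_ae :
  measurable_fun setT (dist_tilde P a V) /\
  ae_eq P setT (dist_tilde P a V) (fun w => c (Z 0%N w, Z 1%N w)).
Proof.
have [[_ ti _ _] tc] := condexpP m_V01 centered_is_condexp.
by split => //; exact: finite_expectation_measurable ti.
Qed.

End tilde.

End metric_kernel.

(** * Comparison of the three covariances *)

Lemma expectation_Rintegral {R : realType} {d : measure_display}
    {T : measurableType d} (P : probability T R) (f : T -> R) :
  has_finite_expectation P f -> 'E_P[f]%E = (\int[P]_w f w)%:E.
Proof. by move=> fi; rewrite unlock /Rintegral fineK// integrable_fin_num. Qed.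

Lemma finite_moment_law {R : realType} {d dU : measure_display}
    {Omega : measurableType d} {U : measurableType dU} (P : probability Omega R)
    (W : {RV P >-> U}) (M : pmetricType R) (o : M) (pr : U -> borel M) (p : R) :
  measurable_fun setT pr -> finite_moment P o p (pr \o W : Omega -> M) ->
  has_finite_expectation (distribution P W)
    (fun u : U => mdist (pr u : M) o `^ p).
Proof.
move=> mpr; rewrite /finite_moment unlock => fin.
have mp := measurable_mdist_pow o mpr p.
apply/integrableP; split; first exact/measurable_EFinP.
apply: le_lt_trans fin; rewrite le_eqVlt; apply/orP; left; apply/eqP.
rewrite ge0_integral_distribution//; last first.
  by apply: measurableT_comp => //; exact/measurable_EFinP.
by apply: eq_integral => w _; rewrite /= ger0_norm// powR_ge0.
Qed.

(** Serves to replace the chosen conditional expectations, known only up to null sets, by centered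
    kernels inside the expectation. *)
Lemma ae_eq_prod_expectation {R : realType} {d : measure_display}
    {T : measurableType d} (P : probability T R) (f f' g g' : T -> R) :
  measurable_fun setT f -> measurable_fun setT g ->
  ae_eq P setT f f' -> ae_eq P setT g g' ->
  has_finite_expectation P (fun w => f' w * g' w) ->
  has_finite_expectation P (f \* g) /\
  'E_P[f \* g]%E = (\int[P]_w (f' w * g' w))%:E.
Proof.
move=> mf mg ff' gg' fi'.
have mfg : measurable_fun setT (EFin \o (f \* g)).
  exact/measurable_EFinP/measurable_funM.
have mfg' := measurable_int _ fi'.
have fg : ae_eq P setT (EFin \o (f \* g)) (EFin \o (fun w => f' w * g' w)).
  by apply: filterS2 ff' gg' => w /= fw gw _; rewrite fw// gw.
have fi : has_finite_expectation P (f \* g).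
  apply/integrableP; split => //.
  have /integrableP[_] := fi'; apply: le_lt_trans.
  rewrite le_eqVlt; apply/orP; left; apply/eqP; apply: ae_eq_integral => //.
  - exact: measurableT_comp.
  - exact: measurableT_comp.
  - exact: (ae_eq_comp abse fg).
split => //; rewrite expectation_Rintegral//; congr (fine _)%:E.
exact: ae_eq_integral.
Qed.

Theorem theorem3p5 (R : realType) (alpha : R) (alpha_gt0 : 0 < alpha)
    (S T : pmetricType R) (sepS : separable_space S) (sepT : separable_space T)
    (xo : S) (yo : T)
    (d0 : measure_display) (Omega0 : measurableType d0)
    (P0 : probability Omega0 R) (XY : {RV P0 >-> (borel S * borel T)%type})
    (d : measure_display) (Omega : measurableType d)
    (P : probability Omega R) (XYs : nat -> {RV P >-> (borel S * borel T)%type})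
    (copies : independent_copies XY XYs) :
  let X : Omega0 -> S := fst \o XY in
  let Y : Omega0 -> T := snd \o XY in
  let Xs : nat -> Omega -> S := fun i => fst \o XYs i in
  let Ys : nat -> Omega -> T := fun i => snd \o XYs i in
  let moment_star :=
    finite_moment P0 xo (2 * alpha) X /\ finite_moment P0 yo (2 * alpha) Y in
  let moment_hat :=
    finite_moment P0 xo (alpha_star alpha) X /\
    finite_moment P0 yo (alpha_star alpha) Y in
  [/\ moment_star -> dcov_star_finite P alpha Xs Ys,
      moment_hat ->
        dcov_hat_finite P alpha Xs Ys /\ dcov_tilde_finite P alpha Xs Ys &
      [/\ moment_star -> moment_hat ->
            dcov_star P alpha Xs Ys = dcov_hat P alpha Xs Ys,
          moment_star -> moment_hat ->
            dcov_star P alpha Xs Ys = dcov_tilde P alpha Xs Ys &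
          moment_hat -> dcov_hat P alpha Xs Ys = dcov_tilde P alpha Xs Ys]].
Proof.
move=> X Y Xs Ys moment_star moment_hat.
have [lawZ indZ] := copies.
pose nu : probability (borel S * borel T)%type R := distribution P0 XY.
have {}lawZ i A : measurable A -> P (XYs i @^-1` A) = nu A by exact: lawZ.
pose k := @mdist_kernel _ _ (borel S * borel T)%type S alpha fst.
pose l := @mdist_kernel _ _ (borel S * borel T)%type T alpha snd.
pose c := centered nu XYs k; pose e := centered nu XYs l.
pose sS (x : borel S) : borel S * borel T := (x, point).
pose sT (y : borel T) : borel S * borel T := (point, y).
have msS : measurable_fun setT sS by exact: measurable_fun_pair.
have msT : measurable_fun setT sT by exact: measurable_fun_pair.
(* The common value: each covariance is shown equal to [I] under its own moment condition, and the
   three comparisons follow. *)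
pose I := \int[P]_w (c (XYs 0%N w, XYs 1%N w) * e (XYs 0%N w, XYs 1%N w)).
have star : moment_star ->
    dcov_star_finite P alpha Xs Ys /\ dcov_star P alpha Xs Ys = I%:E.
  move=> [/(finite_moment_law measurable_fst) mX].
  move=> /(finite_moment_law measurable_snd) mY.
  have kh := centerable_mdist_star lawZ indZ sepS alpha_gt0 measurable_fst mX.
  have lg := centerable_mdist_star lawZ indZ sepT alpha_gt0 measurable_snd mY.
  have [wh wg] := (centerable_weight kh, centerable_weight lg).
  have [mk ml] := (centerable_measurable kh, centerable_measurable lg).
  have kd := mdist_kernel_dominated xo alpha_gt0 (fst : borel S * borel T -> S).
  have ld := mdist_kernel_dominated yo alpha_gt0 (snd : borel S * borel T -> T).
  have i1 := @pair_prod_int _ _ _ _ _ _ _ _ lawZ indZ k l _ _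
    0 1 2 3 0 1 2 3 isT isT wh wg mk ml kd ld.
  have i2 := @pair_prod_int _ _ _ _ _ _ _ _ lawZ indZ k l _ _
    0 1 2 3 0 2 1 3 isT isT wh wg mk ml kd ld.
  have [ik il] := (centerable_int kh, centerable_int lg).
  split; first by [].
  rewrite /I (centered_prodE lawZ indZ kh lg kd ld) /dcov_star.
  rewrite (expectation_Rintegral i1) (expectation_Rintegral i2).
  by rewrite (expectation_Rintegral ik) (expectation_Rintegral il).
have hat : moment_hat ->
    [/\ dcov_hat_finite P alpha Xs Ys, dcov_tilde_finite P alpha Xs Ys,
        dcov_hat P alpha Xs Ys = I%:E & dcov_tilde P alpha Xs Ys = I%:E].
  move=> [/(finite_moment_law measurable_fst) mX].
  move=> /(finite_moment_law measurable_snd) mY.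
  have kh := centerable_mdist_hat lawZ indZ sepS alpha_gt0 measurable_fst mX.
  have lg := centerable_mdist_hat lawZ indZ sepT alpha_gt0 measurable_snd mY.
  have hi := cycle_prod_int lawZ indZ kh lg.
  have ci := centered_prod_int lawZ indZ kh lg.
  have [mtX tX] := dist_tilde_ae lawZ indZ measurable_fst msS (fun=> erefl) kh.
  have [mtY tY] := dist_tilde_ae lawZ indZ measurable_snd msT (fun=> erefl) lg.
  have [ti Et] := ae_eq_prod_expectation mtX mtY tX tY ci.
  split=> //.
  - split=> //.
      exact: (dist_tilde_finite_kernel lawZ indZ (fun=> erefl) kh (sec := sS)).
    exact: (dist_tilde_finite_kernel lawZ indZ (fun=> erefl) lg (sec := sT)).
  - rewrite /dcov_hat (expectation_Rintegral hi) -EFinM; congr EFin.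
    by rewrite (cycle_prodE lawZ indZ kh lg) mulKf.
split; first by case/star.
  by case/hat.
split; first by move=> /star[_ ->] /hat[_ _ ->].
  by move=> /star[_ ->] /hat[_ _ _ ->].
by move=> /hat[_ _ -> ->].
Qed.
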